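(* Let $n\ge2$, let $\Omega\subset\mathbb{R}^n$ be a domain, let $E\subset\Omega$ be a smooth closed submanifold of dimension $k$, $1\le k\le n-2$, and let $U$ be an open subset of $\mathcal{S}^{n\times n}$ such that $M+N\in U$ for every $M\in U$ and every positive definite $N\in\mathcal{S}^{n\times n}$, and such that $U$ has Property $P_k$. Let $\widetilde L:\mathbb{R}^n\times\mathbb{R}\times\mathbb{R}^n\to\mathcal{S}^{n\times n}$ be locally Lipschitz, and for a $C^2$ function $u$ write $\widetilde A^u:=-\nabla^2u+\widetilde L(\cdot,u,\nabla u)$. Assume that $u\in C^2(\Omega\setminus E)$ satisfies $$\lambda_1(\nabla^2u)+\cdots+\lambda_{k+2}(\nabla^2u)\le0\qquad\text{in }\Omega\setminus E,$$ that $v\in C^2(\Omega)$, and that $$\widetilde A^u\in\overline U\quad\text{in }\Omega\setminus E,\qquad\widetilde A^v\in\mathcal{S}^{n\times n}\setminus U\quad\text{in }\Omega,\qquad u>v\quad\text{in }\Omega\setminus E.$$ Then $$\liminf_{x\in\Omega\setminus E,\ \mathrm{dist}(x,E)\to0}(u-v)(x)>0.$$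
   Context: A domain is a bounded connected open set. $\mathcal{S}^{n\times n}$ is the set of real symmetric $n\times n$ matrices; $I$ is the identity matrix; $\overline U$ is the closure of $U$ in $\mathcal{S}^{n\times n}$. For a symmetric matrix $M$, its eigenvalues are ordered as $\lambda_1(M)\le\cdots\le\lambda_n(M)$. A closed submanifold is a compact submanifold without boundary. Property $P_k$ (for an open $U\subset\mathcal{S}^{n\times n}$ and $1\le k\le n-1$): given any constant $C>0$, there exist constants $\bar\delta=\bar\delta(C)>0$ and $\bar\epsilon=\bar\epsilon(C)>0$ such that for any $0<\epsilon<\bar\epsilon$, any $M\in\overline U$ with $M\le CI$, and any $N\in\mathcal{S}^{n\times n}$ with $\lambda_i(N)=-\bar\delta$ for $1\le i\le k$ and $\lambda_j(N)=1$ for $k+1\le j\le n$, we have $M+\epsilon N\in U$. *)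

(* Defs.v *)
From HB Require Import structures.
From mathcomp Require Import all_boot all_order all_algebra complex.
From mathcomp Require Import all_classical all_reals all_analysis.
Set Implicit Arguments.
Unset Strict Implicit.
Unset Printing Implicit Defensive.
Import Order.TTheory GRing.Theory Num.Theory.
Import numFieldNormedType.Exports.
Local Open Scope classical_set_scope.
Local Open Scope ring_scope.

(* Points of R^n are row vectors.  The library norm on 'rV[R]_n and 'M[R]_n is
   the sup norm; it is used only through the topology, boundedness and the
   Lipschitz property, which do not depend on the choice of the norm.  The
   distance to a set is the Euclidean one. *)

Section SymmetricMatrices.
Context {R : realType} {n : nat}.
Implicit Types (M N : 'M[R]_n) (U : set 'M[R]_n).

Definition symmx : set 'M[R]_n := [set M | M^T = M].

Definition quadform M (x : 'rV[R]_n) : R := (x *m M *m x^T) 0 0.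

Definition posdefmx M := symmx M /\ forall x, x != 0 -> 0 < quadform M x.

Definition possemidefmx M := symmx M /\ forall x, 0 <= quadform M x.

Definition loewner_le M N := possemidefmx (N - M).

(* The roots of the characteristic polynomial, with multiplicity, in
   nondecreasing order; junk value [::] when it does not split over R, which
   does not happen for symmetric matrices by eigenvaluesP. *)
Definition eigenvalues M : seq R :=
  xget [::] [set s | sorted <=%R s /\ char_poly M = \prod_(a <- s) ('X - a%:P)].

Lemma eigenvaluesP M : symmx M ->
  sorted <=%R (eigenvalues M) /\ char_poly M = \prod_(a <- eigenvalues M) ('X - a%:P).
Proof.
move=> sM; rewrite /eigenvalues; case: xgetP => [//|] H; exfalso.
pose f := real_complex R.
pose A : 'M[complex R]_n := map_mx f M.
have hA : A \is hermsymmx.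
  apply/is_hermitianmxP; rewrite expr0 scale1r.
  apply/matrixP => i j; rewrite !mxE.
  have -> : M i j = M j i by rewrite -{1}sM mxE.
  by apply/esym/CrealP; rewrite /f /= complex_real.
have /orthomx_spectralP e := hermitian_normalmx hA.
have dr := hermitian_spectral_diag_real hA.
pose d := spectral_diag A.
pose s := [seq complex.Re (d 0 i) | i <- enum 'I_n].
have Pu := spectral_unit A.
have cA : char_poly A = char_poly (diag_mx d).
  have cPi : map_mx polyC (invmx (spectralmx A)) *m map_mx polyC (spectralmx A) = 1%:M.
    by rewrite -map_mxM mulVmx// map_mx1.
  have cdet : \det (map_mx polyC (invmx (spectralmx A))) * \det (map_mx polyC (spectralmx A)) = 1.
    by rewrite -det_mulmx cPi det1.
  rewrite {1}e /char_poly /char_poly_mx !map_mxM.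
  set Q := map_mx _ (invmx _); set P := map_mx _ (spectralmx _).
  have -> : 'X%:M - Q *m map_mx polyC (diag_mx (spectral_diag A)) *m P =
     Q *m ('X%:M - map_mx polyC (diag_mx (spectral_diag A))) *m P.
    rewrite mulmxBr mulmxBl; congr (_ - _).
    by rewrite mul_mx_scalar -scalemxAl cPi scalemx1.
  by rewrite !det_mulmx mulrAC cdet mul1r.
rewrite (char_poly_trig (diag_mx_is_trig d)) in cA.
have cM : char_poly M = \prod_(a <- s) ('X - a%:P).
  apply: (@map_poly_inj _ _ f); rewrite map_char_poly -/A cA rmorph_prod /= /s big_map big_enum.
  apply: eq_bigr => i _; rewrite rmorphB /= map_polyX map_polyC /= mxE eqxx mulr1n.
  congr (_ - _%:P).
  have /mxOverP/(_ 0 i) := dr; rewrite -/d; case: (d 0 i) => a b.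
  by rewrite complex_real => /eqP ->.
apply: (H (sort <=%R s)); split; first exact: sort_le_sorted.
by rewrite cM; apply/esym/perm_big; rewrite perm_sort.
Qed.

(* One-based: lambda M 1 <= ... <= lambda M n. *)
Definition lambda M (i : nat) : R := (eigenvalues M)`_i.-1.

(* U is an open subset of the space of symmetric matrices.  That space is
   closed in 'M[R]_n, so the closure of such a U relative to it is the ambient
   closure U. *)
Definition open_in_symmx U := exists2 V, open V & U = V `&` symmx.

Definition property_P (k : nat) U :=
  forall C : R, 0 < C ->
  exists delta epsbar : R, [/\ 0 < delta, 0 < epsbar &
    forall (eps : R) M N,
      0 < eps < epsbar ->
      closure U M -> loewner_le M C%:M ->
      symmx N ->
      (forall i, (1 <= i <= k)%N -> lambda N i = - delta) ->
      (forall j, (k.+1 <= j <= n)%N -> lambda N j = 1) ->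
      U (M + eps *: N)].

End SymmetricMatrices.

Section Calculus.
Context {R : realType} {n : nat}.
Implicit Types (f u : 'rV[R]_n -> R) (W : set 'rV[R]_n) (x : 'rV[R]_n).

Definition partial (i : 'I_n) f x : R := 'D_(delta_mx 0 i : 'rV[R]_n) f x.

Definition grad u x : 'rV[R]_n := \row_i partial i u x.

Definition hess u x : 'M[R]_n := \matrix_(i, j) partial i (partial j u) x.

(* C^m regularity on an open set W. *)
Fixpoint C_on (m : nat) W f : Prop :=
  (forall x, W x -> {for x, continuous f}) /\
  (if m is m'.+1 then
     forall i : 'I_n,
       (forall x, W x -> derivable f x (delta_mx 0 i : 'rV[R]_n)) /\
       C_on m' W (partial i f)
   else True).

Definition smooth_on W (phi : 'rV[R]_n -> 'rV[R]_n) :=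
  forall (m : nat) (i : 'I_n), C_on m W (fun x => phi x 0 i).

Definition domain W := [/\ bounded_set W, connected W & open W].

(* A k-dimensional embedded smooth submanifold: near each of its points, a
   smooth diffeomorphism phi : W -> V between open sets (with inverse psi)
   straightens E to the coordinate subspace x_k = ... = x_(n-1) = 0. *)
Definition smooth_submanifold (k : nat) (E : set 'rV[R]_n) :=
  forall p, E p -> exists (W V : set 'rV[R]_n) (phi psi : 'rV[R]_n -> 'rV[R]_n),
    [/\ [/\ open W, W p & open V],
        smooth_on W phi /\ smooth_on V psi,
        forall x, W x -> V (phi x) /\ psi (phi x) = x,
        forall y, V y -> W (psi y) /\ phi (psi y) = y &
        forall x, W x -> (E x <-> forall i : 'I_n, (k <= i)%N -> phi x 0 i = 0)].

Definition closed_submanifold (k : nat) (E : set 'rV[R]_n) :=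
  compact E /\ smooth_submanifold k E.

Definition locally_lipschitz (L : 'rV[R]_n * R * 'rV[R]_n -> 'M[R]_n) :=
  forall p : 'rV[R]_n * R * 'rV[R]_n, exists2 W, nbhs p W & [lipschitz L q | q in W].

Definition Atilde (L : 'rV[R]_n * R * 'rV[R]_n -> 'M[R]_n) u x : 'M[R]_n :=
  - hess u x + L (x, u x, grad u x).

Definition eucl_norm x : R := Num.sqrt (\sum_i x 0 i ^+ 2).

(* Extended-real valued, so that dist x set0 = +oo. *)
Definition dist x (E : set 'rV[R]_n) : \bar R :=
  ereal_inf [set (eucl_norm (x - y))%:E | y in E].

(* The filter "x in D, dist(x, E) -> 0". *)
Definition approach (D E : set 'rV[R]_n) : set_system 'rV[R]_n :=
  filter_from [set r : R | 0 < r]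
    (fun r => [set x | D x /\ (dist x E < r%:E)%E]).

End Calculus.

(* Main.v *)
Require Import Defs.
From HB Require Import structures.
From mathcomp Require Import all_boot all_order all_algebra complex.
From mathcomp Require Import all_classical all_reals all_analysis.
From mathcomp Require Import ring lra.
Import Order.TTheory GRing.Theory Num.Theory.
Import numFieldNormedType.Exports.
Local Open Scope classical_set_scope.
Local Open Scope ring_scope.

(** By compactness of E it suffices to bound u - v below near a point p of E.
    Property P_k first gives linear growth: with w the quadratic function
    |normal part of x - p|^2 - d |x - p|^2, which is nonpositive on E near p, and
    y_i the defining functions of E, u - v >= eps (w +- kappa y_i), because an
    interior contact point off E would put Atilde^v into U.  Hence u - v - eps w
    dominates a multiple of the distance d to E, so also K d^2 near p for any K.
    The hypothesis on the sum of k + 2 eigenvalues then makes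
    v + eps w - |x - p|^2 + eta + K d^2 + tau (2 ln d + lam d)
    a strict barrier from below: the first k + 2 eigenvalues of its Hessian have
    a positive sum.  Letting tau tend to 0 yields u - v >= eta / 4 near p.
    At a contact point d^2 is replaced by a quadratic lower bound built from the
    nearest point of E, which avoids any regularity of the distance function. *)

(** Two stages are needed because Hess v is merely bounded: a barrier can have a positive eigenvalue
    sum only if it contains K |x - E|^2 with K large, whereas Property P_k provides perturbations of
    an uncontrolled size eps. Growth that is linear in the distance beats K |x - E|^2 for every K,
    once the neighbourhood is small. With Q the tangential projection at p, eps w has Hessian 2 eps
    ((1 - d) I - Q): about 2 eps on normal vectors and -2 eps d on tangential ones. It therefore
    exceeds eps N for N = (I - Q) - delta Q, with room for the y_i and for the difference of the two
    values of L. This works because delta depends only on a bound for Atilde^u at contact points,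
    which is available before d, kappa and eps are chosen. The number k + 2 is the exact threshold
    for the logarithm of the distance s: 2 ln s has second derivative -2 / s^2 radially, 2 / s^2 in
    the other normal directions and 0 along a flat E. Among k + 2 orthonormal directions at least
    two dimensions are normal, so the worst sum is zero. Curvature of E costs a relative error of
    order s, which the term lam s pays for. *)

Section EuclideanGeometry.
Context {R : realType} {n : nat}.
Implicit Types (x y z : 'rV[R]_n) (M : 'M[R]_n) (a : R).

(** Euclidean estimates are carried by squared lengths, which are polynomial, and are compared with
    the sup norm only up to factors of n. *)
Definition dot x y : R := (x *m y^T) 0 0.
Definition sq x : R := dot x x.

Lemma dotE x y : dot x y = \sum_i x 0 i * y 0 i.
Proof. by rewrite /dot mxE; apply: eq_bigr => i _; rewrite mxE. Qed.

Lemma dotC x y : dot x y = dot y x.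
Proof. by rewrite !dotE; apply: eq_bigr => i _; rewrite mulrC. Qed.

Lemma dotDl x y z : dot (x + y) z = dot x z + dot y z.
Proof. by rewrite /dot mulmxDl mxE. Qed.

Lemma dotDr x y z : dot z (x + y) = dot z x + dot z y.
Proof. by rewrite ![dot z _]dotC dotDl. Qed.

Lemma dotZl a x y : dot (a *: x) y = a * dot x y.
Proof. by rewrite /dot -scalemxAl mxE. Qed.

Lemma dotZr a x y : dot x (a *: y) = a * dot x y.
Proof. by rewrite dotC dotZl dotC. Qed.

Lemma dotNl x y : dot (- x) y = - dot x y.
Proof. by rewrite -scaleN1r dotZl mulN1r. Qed.

Lemma dotNr x y : dot x (- y) = - dot x y.
Proof. by rewrite dotC dotNl dotC. Qed.

Lemma dot0l x : dot 0 x = 0.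
Proof. by rewrite -(scale0r 0) dotZl mul0r. Qed.

Lemma dot0r x : dot x 0 = 0.
Proof. by rewrite dotC dot0l. Qed.

Lemma dot_mull M x y : dot (x *m M) y = dot x (y *m M^T).
Proof. by rewrite /dot trmx_mul trmxK mulmxA. Qed.

Lemma quadformE M x : quadform M x = dot (x *m M) x.
Proof. by []. Qed.

Lemma sqE x : sq x = \sum_i x 0 i ^+ 2.
Proof. by rewrite /sq dotE; apply: eq_bigr. Qed.

Lemma sq_ge0 x : 0 <= sq x.
Proof. by rewrite sqE; apply: sumr_ge0 => i _; rewrite sqr_ge0. Qed.

Lemma sqD x y : sq (x + y) = sq x + 2 * dot x y + sq y.
Proof. by rewrite /sq !dotDl !dotDr (dotC y x); ring. Qed.

Lemma sqN x : sq (- x) = sq x.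
Proof. by rewrite /sq dotNl dotNr opprK. Qed.

Lemma sqB x y : sq (x - y) = sq x - 2 * dot x y + sq y.
Proof. by rewrite sqD sqN dotNr; ring. Qed.

Lemma sqZ a x : sq (a *: x) = a ^+ 2 * sq x.
Proof. by rewrite /sq dotZl dotZr; ring. Qed.

Lemma sq0 : sq 0 = 0. Proof. exact: dot0l. Qed.

Lemma sq_eq0 x : (sq x == 0) = (x == 0).
Proof.
apply/idP/idP => [|/eqP->]; last by rewrite sq0.
rewrite sqE psumr_eq0 => [/allP h|i _]; last exact: sqr_ge0.
apply/eqP/rowP => i; rewrite mxE; apply/eqP; rewrite -sqrf_eq0.
by apply: h; rewrite mem_index_enum.
Qed.

Lemma sq_gt0 x : (0 < sq x) = (x != 0).
Proof. by rewrite lt_def sq_ge0 andbT sq_eq0. Qed.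

Lemma cauchy_schwarz x y : dot x y ^+ 2 <= sq x * sq y.
Proof.
have [->|y0] := eqVneq y 0; first by rewrite dot0r sq0 mulr0 expr0n.
have sy : 0 < sq y by rewrite sq_gt0.
have := sq_ge0 (sq y *: x - dot x y *: y).
rewrite sqB !sqZ dotZl dotZr => h.
have {h} : 0 <= sq y * (sq x * sq y - dot x y ^+ 2) by nra.
by rewrite pmulr_rge0// subr_ge0.
Qed.

Lemma eucl_normE x : eucl_norm x = Num.sqrt (sq x).
Proof. by rewrite sqE. Qed.

Lemma eucl_norm_ge0 x : 0 <= eucl_norm x.
Proof. by rewrite eucl_normE sqrtr_ge0. Qed.

Lemma sqr_eucl_norm x : eucl_norm x ^+ 2 = sq x.
Proof. by rewrite eucl_normE sqr_sqrtr// sq_ge0. Qed.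

Lemma eucl_normN x : eucl_norm (- x) = eucl_norm x.
Proof. by rewrite !eucl_normE sqN. Qed.

Lemma eucl_normZ a x : eucl_norm (a *: x) = `|a| * eucl_norm x.
Proof. by rewrite !eucl_normE sqZ sqrtrM ?sqr_ge0// sqrtr_sqr. Qed.

Lemma eucl_norm_eq0 x : (eucl_norm x == 0) = (x == 0).
Proof. by rewrite -sq_eq0 -sqr_eucl_norm sqrf_eq0. Qed.

Lemma normr_dot_le x y : `|dot x y| <= eucl_norm x * eucl_norm y.
Proof.
rewrite -(@ler_pXn2r _ 2)// ?nnegrE ?mulr_ge0 ?eucl_norm_ge0//.
by rewrite real_normK ?num_real// exprMn !sqr_eucl_norm cauchy_schwarz.
Qed.

Lemma eucl_normD x y : eucl_norm (x + y) <= eucl_norm x + eucl_norm y.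
Proof.
rewrite -(@ler_pXn2r _ 2)// ?nnegrE ?addr_ge0 ?eucl_norm_ge0//.
rewrite sqr_eucl_norm sqD -!sqr_eucl_norm.
by have := le_trans (ler_norm _) (normr_dot_le x y); nra.
Qed.

Lemma normr_le_eucl_norm x : `|x| <= eucl_norm x.
Proof.
rewrite [leLHS]mx_normrE.
apply/bigmax_leP; split=> [|[i j] _ /=]; first exact: eucl_norm_ge0.
rewrite -(@ler_pXn2r _ 2)// ?nnegrE ?eucl_norm_ge0//.
rewrite real_normK ?num_real// sqr_eucl_norm sqE (bigD1 j)//= (ord1 i).
by rewrite lerDl sumr_ge0// => l _; rewrite sqr_ge0.
Qed.

Lemma coord_le_norm x i : `|x 0 i| <= `|x|.
Proof.
rewrite [leRHS]mx_normrE.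
exact: (le_bigmax _ (fun ij : 'I_1 * 'I_n => `|x ij.1 ij.2|) (0, i)).
Qed.

Lemma eucl_norm_le x : eucl_norm x <= n%:R * `|x|.
Proof.
rewrite -(@ler_pXn2r _ 2)// ?nnegrE ?eucl_norm_ge0 ?mulr_ge0//.
rewrite sqr_eucl_norm sqE exprMn.
apply: (@le_trans _ _ (n%:R * `|x| ^+ 2)).
  rewrite mulr_natl -[X in _ *+ X]card_ord -sumr_const ler_sum// => i _.
  by rewrite -[_ ^+ 2]real_normK ?num_real// lerXn2r ?nnegrE// coord_le_norm.
rewrite ler_wpM2r ?sqr_ge0// -natrX ler_nat; case: (n) => // m.
by rewrite expnS leq_pmulr// expn_gt0.
Qed.

Lemma sq_le_norm x : sq x <= n%:R ^+ 2 * `|x| ^+ 2.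
Proof.
rewrite -sqr_eucl_norm -exprMn lerXn2r ?nnegrE ?eucl_norm_ge0 ?mulr_ge0//.
exact: eucl_norm_le.
Qed.

Lemma norm_le_sq x : `|x| ^+ 2 <= sq x.
Proof.
by rewrite -sqr_eucl_norm lerXn2r ?nnegrE ?eucl_norm_ge0// normr_le_eucl_norm.
Qed.

Lemma mx_coord_le M i j : `|M i j| <= `|M|.
Proof.
rewrite [leRHS]mx_normrE.
exact: (le_bigmax _ (fun ij : 'I_n * 'I_n => `|M ij.1 ij.2|) (i, j)).
Qed.

(** Comes from |x_i x_j| <= (x_i^2 + x_j^2) / 2. It turns entrywise bounds on Hessians and on L into
    bounds on forms, and is the source of the factors n in later constants. *)
Lemma quadform_le M a x : (forall i j, `|M i j| <= a) ->
  `|quadform M x| <= a * n%:R * sq x.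
Proof.
move=> hM; rewrite quadformE dotE.
apply: le_trans (ler_norm_sum _ _ _) _.
apply: (@le_trans _ _ (\sum_i \sum_j a * ((x 0 i ^+ 2 + x 0 j ^+ 2) / 2))).
  apply: ler_sum => i _; rewrite mxE mulr_suml.
  apply: le_trans (ler_norm_sum _ _ _) _; apply: ler_sum => j _.
  rewrite !normrM mulrAC mulrC; apply: ler_pM => //.
  rewrite -(real_normK (num_real (x 0 i))) -(real_normK (num_real (x 0 j))).
  by have := sqr_ge0 (`|x 0 i| - `|x 0 j|); lra.
under eq_bigr do rewrite -mulr_sumr -mulr_suml big_split /= sumr_const card_ord -sqE.
rewrite -mulr_sumr -mulr_suml big_split /= sumr_const card_ord sumrMnl -sqE.
rewrite -mulr_natl; lra.
Qed.

End EuclideanGeometry.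

(** * Quadratic forms and orthogonal projections *)

Section QuadraticForms.
Context {R : realType} {n : nat}.
Implicit Types (x y : 'rV[R]_n) (M N : 'M[R]_n) (a : R).

Lemma quadformD M N x : quadform (M + N) x = quadform M x + quadform N x.
Proof. by rewrite /quadform mulmxDr mulmxDl mxE. Qed.

Lemma quadformZ a M x : quadform (a *: M) x = a * quadform M x.
Proof. by rewrite /quadform -scalemxAr -scalemxAl mxE. Qed.

Lemma quadformN M x : quadform (- M) x = - quadform M x.
Proof. by rewrite -scaleN1r quadformZ mulN1r. Qed.

Lemma quadformB M N x : quadform (M - N) x = quadform M x - quadform N x.
Proof. by rewrite quadformD quadformN. Qed.

Lemma quadform_scalar a x : quadform a%:M x = a * sq x.
Proof. by rewrite quadformE mul_mx_scalar dotZl. Qed.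

Lemma quadform1 x : quadform 1%:M x = sq x.
Proof. by rewrite quadform_scalar mul1r. Qed.

Lemma quadform_sum M x :
  quadform M x = \sum_i \sum_j x 0 i * x 0 j * M i j.
Proof.
rewrite quadformE dotE exchange_big; apply: eq_bigr => j _ /=.
by rewrite mxE mulr_suml; apply: eq_bigr => i _; ring.
Qed.

Lemma symmxD M N : symmx M -> symmx N -> symmx (M + N).
Proof. by rewrite /symmx /= => hM hN; rewrite linearD /= hM hN. Qed.

Lemma symmxN M : symmx M -> symmx (- M).
Proof. by rewrite /symmx /= => hM; rewrite linearN /= hM. Qed.

Lemma symmxZ a M : symmx M -> symmx (a *: M).
Proof. by rewrite /symmx /= => hM; rewrite linearZ /= hM. Qed.

Lemma symmx_scalar a : @symmx R n a%:M.
Proof. exact: tr_scalar_mx. Qed.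

(** Acts on row vectors from the right. For a symmetric idempotent the trace is the rank, so
    dimension is recorded without a basis. *)
Definition orthoproj (k : nat) (Q : 'M[R]_n) :=
  [/\ symmx Q, Q *m Q = Q & \tr Q = k%:R].

Lemma orthoproj_dot k Q x y : orthoproj k Q -> dot (x *m Q) y = dot x (y *m Q).
Proof. by case=> sQ _ _; rewrite dot_mull sQ. Qed.

Lemma orthoproj_dotE k Q x y :
  orthoproj k Q -> dot (x *m Q) (y *m Q) = dot x (y *m Q).
Proof. by move=> hQ; rewrite (orthoproj_dot _ _ _ _ hQ) -mulmxA; case: hQ => _ -> _. Qed.

Lemma orthoproj_quadform k Q x : orthoproj k Q -> quadform Q x = sq (x *m Q).
Proof. by move=> hQ; rewrite quadformE /sq (orthoproj_dotE _ _ _ _ hQ) (orthoproj_dot _ _ _ _ hQ). Qed.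

Lemma orthoproj_pythagoras k Q x :
  orthoproj k Q -> sq x = sq (x *m Q) + sq (x *m (1%:M - Q)).
Proof.
move=> hQ; have e : sq (x *m Q) = dot x (x *m Q) by exact: orthoproj_dotE hQ.
by rewrite mulmxBr mulmx1 sqB e; ring.
Qed.

End QuadraticForms.

(** * Diagonalization of symmetric matrices and frames for the lowest eigenvalues *)

Section SpectralTheory.
Context {R : realType} {n : nat}.
Implicit Types (M N Q : 'M[R]_n) (x y : 'rV[R]_n).

Let Re_sum (I : finType) (F : I -> R[i]) :
  complex.Re (\sum_i F i) = \sum_i complex.Re (F i).
Proof. by apply: (big_morph (@complex.Re R)) => // -[? ?] [? ?]. Qed.

Let Im_sum (I : finType) (F : I -> R[i]) :
  complex.Im (\sum_i F i) = \sum_i complex.Im (F i).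
Proof. by apply: (big_morph (@complex.Im R)) => // -[? ?] [? ?]. Qed.

Let Re_mul_conj (u v : R[i]) :
  complex.Re (u * v^*) = complex.Re u * complex.Re v + complex.Im u * complex.Im v.
Proof. by case: u v => [a b] [c d] /=; ring. Qed.

Let Re_mul_real (u : R[i]) (a : R) : complex.Re (u * a%:C%C) = complex.Re u * a.
Proof. by case: u => [b c] /=; ring. Qed.

Let Im_mul_real (u : R[i]) (a : R) : complex.Im (u * a%:C%C) = complex.Im u * a.
Proof. by case: u => [b c] /=; ring. Qed.

Lemma char_poly_conj (F : fieldType) (m : nat) (P A B : 'M[F]_m) :
  P \in unitmx -> P *m A = B *m P -> char_poly A = char_poly B.
Proof.
move=> Pu PA; pose q := map_mx polyC P.
have qu : \det q != 0.
  rewrite det_map_mx polyC_eq0; by move: Pu; rewrite unitmxE unitfE.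
apply: (mulfI qu); rewrite /char_poly -det_mulmx [RHS]mulrC -det_mulmx.
congr (\det _); rewrite /char_poly_mx mulmxBr mulmxBl -!map_mxM PA.
by rewrite mul_mx_scalar mul_scalar_mx.
Qed.

(* X and Y are the real and imaginary parts of a unitary diagonalization. *)
Lemma symmx_real_diagonalization M : symmx M ->
  exists X Y : 'M[R]_n, exists a : 'I_n -> R,
   [/\ X^T *m X + Y^T *m Y = 1%:M,
       forall i, sq (row i X) + sq (row i Y) = 1,
       (forall i, row i X *m M = a i *: row i X),
       (forall i, row i Y *m M = a i *: row i Y) &
       char_poly M = \prod_(b <- [seq a i | i <- enum 'I_n]) ('X - b%:P)].
Proof.
move=> sM.
pose f := real_complex R.
pose A : 'M[complex R]_n := map_mx f M.
have hA : A \is hermsymmx.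
  apply/is_hermitianmxP; rewrite expr0 scale1r.
  apply/matrixP => i j; rewrite !mxE.
  have -> : M i j = M j i by rewrite -{1}sM mxE.
  by apply/esym/CrealP; rewrite /f /= complex_real.
have /orthomx_spectralP e := hermitian_normalmx hA.
have dr := hermitian_spectral_diag_real hA.
have Pu := spectral_unit A.
have Punit := spectral_unitarymx A.
set P := spectralmx A in e Pu Punit; set d := spectral_diag A in e dr.
pose a i := complex.Re (d 0 i).
have da i : d 0 i = f (a i).
  have /mxOverP/(_ 0 i) := dr; rewrite /a; case: (d 0 i) => u v.
  by rewrite complex_real => /eqP ->.
have PA : P *m A = diag_mx d *m P by rewrite {1}e !mulmxA mulmxV// mul1mx.
have PMij i j : \sum_l P i l * f (M l j) = P i j * f (a i).
  have /matrixP/(_ i j) := PA; rewrite mul_diag_mx !mxE da mulrC => <-.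
  by apply: eq_bigr => l _; rewrite mxE.
have /unitarymxP PP := Punit.
exists (map_mx (@complex.Re R) P), (map_mx (@complex.Im R) P), a; split.
- apply/matrixP => i j; have /matrixP/(_ j i) := mulmx1C PP.
  rewrite !mxE -big_split/= => h.
  transitivity (complex.Re ((j == i)%:R : R[i])); last first.
    by rewrite eq_sym; case: eqP.
  rewrite -h Re_sum; apply: eq_bigr => l _.
  rewrite !mxE [X in _ = complex.Re X]mulrC Re_mul_conj; ring.
- move=> i; have /matrixP/(_ i i) := PP; rewrite !sqE -big_split /= !mxE eqxx => h.
  transitivity (complex.Re (true%:R : R[i])) => //; rewrite -h Re_sum.
  by apply: eq_bigr => l _; rewrite !mxE Re_mul_conj; ring.
- move=> i; apply/rowP => j; rewrite !mxE; have := congr1 (@complex.Re R) (PMij i j).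
  rewrite Re_sum Re_mul_real mulrC => <-; apply: eq_bigr => l _.
  by rewrite !mxE Re_mul_real.
- move=> i; apply/rowP => j; rewrite !mxE; have := congr1 (@complex.Im R) (PMij i j).
  rewrite Im_sum Im_mul_real mulrC => <-; apply: eq_bigr => l _.
  by rewrite !mxE Im_mul_real.
- apply: (@map_poly_inj _ _ f); rewrite map_char_poly -/A (char_poly_conj _ _ _ _ _ Pu PA).
  rewrite (char_poly_trig (diag_mx_is_trig d)) rmorph_prod /= big_map big_enum.
  apply: eq_bigr => i _; rewrite rmorphB /= map_polyX map_polyC /= mxE eqxx mulr1n.
  by rewrite da.
Qed.

Lemma eigenvalues_eq M (s : seq R) : symmx M -> sorted <=%R s ->
  char_poly M = \prod_(a <- s) ('X - a%:P) -> eigenvalues M = s.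
Proof.
move=> sM ss cM; have [se] := eigenvaluesP sM; rewrite cM => h.
by apply: (sorted_eq le_trans le_anti) => //; apply: prod_XsubC_eq.
Qed.

Lemma size_eigenvalues M : symmx M -> size (eigenvalues M) = n.
Proof.
move=> /eigenvaluesP[_ /(congr1 (size \o polyseq))]/=.
by rewrite size_char_poly size_prod_XsubC => -[].
Qed.

Lemma sum_eigenvalues M : symmx M -> \sum_(a <- eigenvalues M) a = \tr M.
Proof.
move=> sM; have sz := size_eigenvalues _ sM; have [_ cM] := eigenvaluesP sM.
have [n0|n0] := posnP n.
  have /size0nil -> : size (eigenvalues M) = 0%N by rewrite sz.
  rewrite big_nil /mxtrace big1// => i.
  by have := ltn_ord i; rewrite [X in (_ < X)%N]n0.
have sz0 : size (eigenvalues M) != 0%N by rewrite sz -lt0n.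
have := coefPn_prod_XsubC sz0; rewrite -cM sz char_poly_trace//.
by move/oppr_inj.
Qed.

(* Real and imaginary parts of complex eigenvectors for the lowest eigenvalues:
   not orthonormal, but a tight enough frame for trace computations. *)
Lemma lowest_eigenframe M (m : nat) : symmx M -> (m <= n)%N ->
  exists e : bool * 'I_m -> 'rV[R]_n,
   [/\ \sum_i sq (e i) = m%:R,
       forall y, \sum_i dot y (e i) ^+ 2 <= sq y &
       \sum_i quadform M (e i) = \sum_(1 <= i < m.+1) lambda M i].
Proof.
move=> sM mn; have [X [Y [a [XY nXY hX hY cM]]]] := symmx_real_diagonalization M sM.
(* Indices sorted by eigenvalue: the first m of them carry the m lowest eigenvalues. *)
pose t := sort (relpre a <=%R) (enum 'I_n).
have st : size t = n by rewrite size_sort size_enum_ord.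
have ev : eigenvalues M = map a t.
  apply: eigenvalues_eq => //; first by rewrite -sort_map sort_le_sorted.
  by rewrite cM; apply: perm_big; apply: perm_map; rewrite perm_sym perm_sort.
have [n0|n0] := posnP n.
  have m0 : m = 0%N by apply/eqP; rewrite -leqn0 -n0.
  subst m; exists (fun=> 0).
  have noI : forall i : bool * 'I_0, False by case=> _ [].
  split; rewrite ?big_geq//; last by rewrite big1// => i; case: (noI i).
    by rewrite big1// => i; case: (noI i).
  by move=> y; rewrite big1 ?sq_ge0// => i; case: (noI i).
pose i0 : 'I_n := Ordinal n0.
pose g (j : 'I_m) := nth i0 t j.
have ut : uniq t by rewrite sort_uniq enum_uniq.
have ginj : injective g.
  move=> i j /eqP; rewrite nth_uniq ?st ?(leq_trans (ltn_ord _) mn)//.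
  by move/eqP/val_inj.
pose Z (b : bool) := if b then X else Y.
have hZ b i : row i (Z b) *m M = a i *: row i (Z b) by case: b.
exists (fun bi => row (g bi.2) (Z bi.1)); split.
- rewrite -(pair_bigA _ (fun b j => sq (row (g j) (Z b)))) /= exchange_big /=.
  under eq_bigr do rewrite big_bool /= nXY.
  by rewrite sumr_const card_ord.
- move=> y.
  rewrite -(pair_bigA _ (fun b j => dot y (row (g j) (Z b)) ^+ 2)) /= exchange_big /=.
  (* Over all n indices this is an equality, because X^T X + Y^T Y = 1; discarding indices outside
     the image of [g] leaves the inequality. *)
  have -> : sq y = \sum_(i : 'I_n) \sum_b dot y (row i (Z b)) ^+ 2.
    rewrite exchange_big /= big_bool /=.
    have E (W : 'M[R]_n) : \sum_i dot y (row i W) ^+ 2 = sq (y *m W^T).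
      rewrite sqE; apply: eq_bigr => i _; congr (_ ^+ 2).
      by rewrite dotE mxE; apply: eq_bigr => j _; rewrite !mxE.
    rewrite !E /sq !dot_mull !trmxK -!mulmxA -dotDr -mulmxDr.
    by rewrite XY mulmx1.
  rewrite (eq_bigl (mem [set: 'I_m]%SET))  => [|i]; last by rewrite /= finset.in_setT.
  rewrite -(big_imset (fun i => \sum_b dot y (row i (Z b)) ^+ 2)) /=; last first.
    by move=> i j _ _; apply: ginj.
  rewrite [leRHS](bigID (mem [set g j | j in [set: 'I_m]]%SET)) /=.
  apply: ler_wpDr; last by [].
  by apply: sumr_ge0 => i _; apply: sumr_ge0 => b _; rewrite sqr_ge0.
- rewrite -(pair_bigA _ (fun b j => quadform M (row (g j) (Z b)))) /= exchange_big /=.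
  (* Shift from the one-based [lambda] to the zero-based [nth]. *)
  rewrite big_add1 /= big_mkord; apply: eq_bigr => j _.
  rewrite big_bool /= !quadformE !hX !hY !dotZl -mulrDr -/(sq _) -/(sq _) nXY mulr1.
  by rewrite /lambda ev /= (nth_map i0) ?st ?(leq_trans (ltn_ord _) mn).
Qed.

End SpectralTheory.

(** * Projections: construction, trace bounds, and test matrices for Property P_k *)

Section OrthogonalProjections.
Context {R : realType} {n : nat}.
Implicit Types (N Q : 'M[R]_n) (x y : 'rV[R]_n).

(** Q = A^T (A A^T)^-1 A projects onto the row space of A; independence of the rows makes the Gram
    matrix invertible. *)
Lemma orthoproj_of_rows (k : nat) (A : 'M[R]_(k, n)) :
  (forall s : 'rV_k, s *m A = 0 -> s = 0) ->
  exists Q, [/\ orthoproj k Q, forall s : 'rV_k, s *m A *m Q = s *m A &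
    forall x, (forall s : 'rV_k, dot x (s *m A) = 0) -> x *m Q = 0].
Proof.
move=> hA; pose B := A *m A^T.
have uB : B \in unitmx.
  rewrite -row_free_unit; apply: inj_row_free => s.
  rewrite /B mulmxA => h; apply: hA; apply/eqP; rewrite -sq_eq0 /sq /dot.
  by rewrite trmx_mul mulmxA h mul0mx mxE.
have sB : B^T = B by rewrite /B trmx_mul trmxK.
exists (A^T *m invmx B *m A); split.
- split.
  + by rewrite /symmx /= !trmx_mul trmxK trmx_inv sB mulmxA.
  + rewrite -!mulmxA (mulmxA A) -/B (mulmxA B) mulmxV// mul1mx.
    by rewrite mulmxA.
  + by rewrite mxtrace_mulC mulmxA -/B mulmxV// mxtrace1.
- move=> s; rewrite -!mulmxA (mulmxA A) -/B (mulmxA B) mulmxV// mul1mx//.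
- move=> x hx; have -> : x *m (A^T *m invmx B *m A) = (x *m A^T) *m (invmx B *m A).
    by rewrite !mulmxA.
  suff -> : x *m A^T = 0 by rewrite mul0mx.
  apply/rowP => i; rewrite [RHS]mxE -(hx (delta_mx 0 i)) dotE mxE.
  apply: eq_bigr => j _; rewrite !mxE (bigD1 i)//= !mxE !eqxx mul1r big1 ?addr0//.
  by move=> l li; rewrite !mxE (negPf li) andbF mul0r.
Qed.

Lemma sum_sq_orthoproj (k : nat) (I : finType) (e : I -> 'rV[R]_n) Q :
  orthoproj k Q -> (forall y, \sum_i dot y (e i) ^+ 2 <= sq y) ->
  \sum_i sq (e i *m Q) <= k%:R.
Proof.
move=> [sQ QQ trQ] he.
have E i : sq (e i *m Q) = \sum_j dot (row j Q) (e i) ^+ 2.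
  rewrite sqE; apply: eq_bigr => j _; congr (_ ^+ 2).
  rewrite dotE mxE; apply: eq_bigr => l _; rewrite mulrC mxE.
  by congr (_ * _); rewrite -{1}sQ mxE.
under eq_bigr do rewrite E.
rewrite exchange_big /=; apply: le_trans (ler_sum _ (fun j _ => he (row j Q))) _.
have -> : k%:R = \tr (Q *m Q) by rewrite QQ.
rewrite /mxtrace le_eqVlt; apply/orP; left; apply/eqP.
apply: eq_bigr => j _; rewrite sqE mxE; apply: eq_bigr => l _.
by rewrite mxE expr2; congr (_ * _); rewrite -{1}sQ mxE.
Qed.

(** N is annihilated by (N + d)(N - 1), so only -d and 1 occur as eigenvalues, and the trace n - (1
    + d) k fixes their multiplicities. Such N are the matrices to which Property P_k is applied. *)
Lemma lambda_orthoproj (k : nat) Q (d : R) :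
  orthoproj k Q -> 0 < d -> (k <= n)%N ->
  let N := 1%:M - (1 + d) *: Q in
  [/\ symmx N, forall i, (1 <= i <= k)%N -> lambda N i = - d &
      forall j, (k.+1 <= j <= n)%N -> lambda N j = 1].
Proof.
move=> [sQ QQ trQ] d0 kn N.
have sN : symmx N.
  by apply: symmxD; [exact: symmx_scalar | apply/symmxN/symmxZ].
have hN : (N + d%:M) *m (N - 1%:M) = 0.
  have -> : N + d%:M = (1 + d) *: (1%:M - Q).
    by apply/matrixP => i j; rewrite !mxE; case: (i == j); rewrite ?mulr1n ?mulr0n; ring.
  have -> : N - 1%:M = - ((1 + d) *: Q) by rewrite /N addrAC subrr add0r.
  by rewrite mulmxN -scalemxAl -scalemxAr mulmxBl mul1mx QQ subrr !scaler0 oppr0.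
have ev : {subset eigenvalues N <= [:: - d; 1]}.
  move=> a; have [_ cN] := eigenvaluesP sN.
  rewrite -root_prod_XsubC -cN -eigenvalue_root_char => /eigenvalueP[v hv v0].
  have : v *m ((N + d%:M) *m (N - 1%:M)) = 0 by rewrite hN mulmx0.
  have -> : v *m ((N + d%:M) *m (N - 1%:M)) = ((a + d) * (a - 1)) *: v.
    have h1 : v *m (N + d%:M) = (a + d) *: v by rewrite mulmxDr hv mul_mx_scalar scalerDl.
    have h2 : v *m (N - 1%:M) = (a - 1) *: v by rewrite mulmxBr hv mulmx1 scalerBl scale1r.
    by rewrite mulmxA h1 -scalemxAl h2 scalerA.
  move/eqP.
  rewrite scaler_eq0 (negPf v0) orbF mulf_eq0 addr_eq0 subr_eq0 !inE.
  by [].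
pose s := eigenvalues N.
have dN1 : (1 == - d) = false by apply/negbTE; rewrite gt_eqF//; lra.
have s1 : [seq a <- s | a == - d] = nseq (count (pred1 (- d)) s) (- d).
  rewrite -size_filter; apply/all_pred1P; exact: filter_all.
have s2 : [seq a <- s | predC (pred1 (- d)) a] =
          nseq (count (predC (pred1 (- d))) s) 1.
  rewrite -size_filter; apply/all_pred1P/allP => a; rewrite mem_filter /= => /andP[ad /ev].
  by rewrite !inE (negPf ad).
have pe : perm_eq (nseq (count (pred1 (- d)) s) (- d) ++ nseq (count (predC (pred1 (- d))) s) 1) s.
  by rewrite -s1 -s2; apply/permPl; apply: perm_filterC.
have cs := count_predC (pred1 (- d)) s.
(* Compare the sum of the eigenvalues with the trace; division by 1 + d gives the multiplicity of
   -d. *)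
have ck : count (pred1 (- d)) s = k.
  have := sum_eigenvalues N sN; rewrite -/s -(perm_big _ pe) /= big_cat /=.
  rewrite !big_nseq !iter_addr_0.
  rewrite /N mxtraceD mxtrace1 linearN /= mxtraceZ trQ.
  have /(congr1 (fun m => m%:R : R)) := cs; rewrite (size_eigenvalues N sN) natrD.
  set c := count (pred1 _) s; set c' := count _ s => <-.
  rewrite mulNrn -(mulr_natl d) => h.
  have : (1 + d) * (c%:R - k%:R) = 0 by lra.
  move/eqP; rewrite mulf_eq0 gt_eqF/=; last by lra.
  by rewrite subr_eq0 eqr_nat => /eqP.
have ss : s = nseq k (- d) ++ nseq (n - k) 1.
  have [so _] := eigenvaluesP sN.
  apply: (sorted_eq le_trans le_anti) => //.
    rewrite sorted_pairwise; last exact: le_trans.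
    rewrite pairwise_cat; apply/and3P; split.
    - apply/allrelP => a b; rewrite !mem_nseq => /andP[_ /eqP->] /andP[_ /eqP->]; lra.
    - by elim: (k) => //= m ->; rewrite andbT; apply/allP => a; rewrite mem_nseq => /andP[_ /eqP->].
    - by elim: (_ - _)%N => //= m ->; rewrite andbT; apply/allP => a; rewrite mem_nseq => /andP[_ /eqP->].
  rewrite perm_sym -{1}ck.
  have -> : (n - k)%N = count (predC (pred1 (- d))) s.
    by rewrite -(size_eigenvalues N sN) -/s -cs ck addKn.
  by [].
have ls i : lambda N i = (nseq k (- d) ++ nseq (n - k) 1)`_i.-1 by rewrite /lambda -/s ss.
split => // [i /andP[i1 ik]|j /andP[j1 jn]]; rewrite ls nth_cat size_nseq nth_nseq.
  by rewrite prednK// ik.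
rewrite ltnNge -ltnS prednK ?j1 ?(leq_trans _ j1)//=.
by rewrite nth_nseq ltn_sub2rE ?prednK ?jn ?(leq_trans _ j1)// -ltnS prednK ?(leq_trans _ j1).
Qed.

End OrthogonalProjections.

(** * Second-order calculus along a line *)

Section OneVariable.
Context {R : realType}.
Implicit Types (f g df : R -> R) (s t : R).

Lemma is_derive1_continuous f (t d : R) : is_derive t 1 f d -> {for t, continuous f}.
Proof. by move=> h; apply: differentiable_continuous; apply/derivable1_diffP. Qed.

(** Exactly what a second-derivative test at 0 consumes: a first derivative near 0 and a second one
    at 0 only. Contact points are tested along lines, so several-variable calculus reduces to
    this. *)
Definition jet2 g (g1 : R -> R) (c : R) :=
  (\forall s \near (0 : R), is_derive s (1 : R) g (g1 s)) /\ is_derive (0 : R) (1 : R) g1 c.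

Lemma jet2D g g1 c f f1 d :
  jet2 g g1 c -> jet2 f f1 d -> jet2 (fun s => g s + f s) (fun s => g1 s + f1 s) (c + d).
Proof.
move=> [hg hg1] [hf hf1]; split; last exact: is_deriveD.
by near=> s; apply: is_deriveD; near: s.
Unshelve. all: by end_near. Qed.

Lemma jet2Z k g g1 c :
  jet2 g g1 c -> jet2 (fun s => k * g s) (fun s => k * g1 s) (k * c).
Proof.
move=> [hg hg1]; split; last exact: is_deriveZ.
by near=> s; apply: is_deriveZ; near: s.
Unshelve. all: by end_near. Qed.

Lemma jet2B g g1 c f f1 d :
  jet2 g g1 c -> jet2 f f1 d -> jet2 (fun s => g s - f s) (fun s => g1 s - f1 s) (c - d).
Proof.
move=> hg /(jet2Z (-1)) hf.
have := jet2D _ _ _ _ _ _ hg hf.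
by under eq_fun do rewrite mulN1r; under [X in jet2 _ X]eq_fun do rewrite mulN1r; rewrite mulN1r.
Qed.

Lemma is_derive_quadratic (a b c s : R) :
  is_derive s 1 (fun t => a + b * t + c * t ^+ 2) (b + 2 * c * s).
Proof.
apply: is_derive_eq.
rewrite /GRing.scale /=; ring.
Qed.

Lemma jet2_quadratic (a b c : R) :
  jet2 (fun t => a + b * t + c * t ^+ 2) (fun t => b + 2 * c * t) (2 * c).
Proof.
split; first by near=> s; apply: is_derive_quadratic.
have -> : (fun t => b + 2 * c * t) = (fun t => b + 2 * c * t + 0 * t ^+ 2).
  by apply/funext => t; rewrite mul0r addr0.
by apply: is_derive_eq (is_derive_quadratic _ _ _ _) _; ring.
Unshelve. all: by end_near. Qed.

Lemma jet2_comp g g1 c f f1 d (D : set R) :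
  open D -> D (g 0) -> (forall t, D t -> is_derive t 1 f (f1 t)) ->
  is_derive (g 0) 1 f1 d -> jet2 g g1 c ->
  jet2 (f \o g) (fun s => f1 (g s) * g1 s) (d * g1 0 ^+ 2 + f1 (g 0) * c).
Proof.
move=> oD Dg hf hf1 [hg hg1]; have hg0 := nbhs_singleton hg.
have cg := is_derive1_continuous _ _ _ hg0.
split.
  near=> s; apply: is_derive1_comp; last by near: s.
  apply: hf; near: s; apply: cg; exact: open_nbhs_nbhs.
have := is_deriveM (is_derive1_comp hf1 hg0) hg1.
move/is_derive_eq; apply; rewrite /GRing.scale /=; ring.
Unshelve. all: by end_near. Qed.

(** After g1 0 = 0, a negative c would make g1 negative just to the right of 0, and the mean value
    theorem would then give g s < g 0. *)
Lemma jet2_min g g1 c : jet2 g g1 c -> (\forall s \near (0 : R), g 0 <= g s) ->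
  g1 0 = 0 /\ 0 <= c.
Proof.
move=> [hg hg1] hmin.
have [r /= r0 hr] : exists2 r, 0 < r & forall s, `|s| < r -> is_derive s 1 g (g1 s) /\ g 0 <= g s.
  have hh : \forall s \near (0 : R), is_derive s (1 : R) g (g1 s) /\ g 0 <= g s.
    exact: filterI hg hmin.
  by have /nbhs_norm0P[r /= r0 hr] := hh; exists r.
have hin s : s \in `]- r, r[ -> `|s| < r by rewrite in_itv/= ltr_norml.
have g10 : g1 0 = 0.
  have h0 : is_derive (0 : R) 1 g 0.
    apply: (@derive1_at_min _ g (- r) r) => [|s /hin/hr[hs _]||s /hin/hr[]//].
    - lra.
    - exact: ex_derive.
    - by rewrite in_itv/=; lra.
  have [h1 _] := hr 0 ltac:(by rewrite normr0).
  by rewrite -(@derive_val _ _ _ _ _ _ _ h1) (@derive_val _ _ _ _ _ _ _ h0).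
split=> //; rewrite leNgt; apply/negP => c0.
have [s [s0 sr hs]] : exists s, [/\ 0 < s, s < r & forall t, 0 < t -> t <= s -> g1 t < 0].
  have hh : \forall h \near (0 : R), h != 0 -> `|c - h^-1 * g1 h| < - c.
    have [hd hv] := hg1.
    have : (h^-1 *: ((g1 \o shift 0) (h *: (1 : R)) - g1 0) @[h --> 0^'] --> c)%R.
      by rewrite -hv; exact: hd.
    move=> /cvgrPdist_lt/(_ (- c) ltac:(lra)); rewrite near_withinE.
    apply: filterS => h hh h0; have := hh h0.
    by rewrite /= g10 subr0 addr0 /GRing.scale /= mulr1.
  have /nbhs_norm0P[d /= d0 hd0] := hh.
  exists (Num.min (d / 2) (r / 2)); split.
  - by rewrite lt_min; apply/andP; split; lra.
  - by rewrite gt_min; apply/orP; right; lra.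
  - move=> t t0; rewrite le_min => /andP[td tr].
    have := hd0 t; rewrite /= gtr0_norm// => /(_ ltac:(lra) ltac:(by rewrite gt_eqF)).
    rewrite ltr_norml => /andP[hl _].
    have : t^-1 * g1 t < 0 by lra.
    by rewrite pmulr_rlt0// invr_gt0.
have hr' t : t \in `[0, s] -> `|t| < r.
  by rewrite in_itv/= => /andP[t0 ts]; rewrite ger0_norm//; lra.
have [|/=|t] := @MVT _ g g1 0 s s0.
- by move=> t ht; have [] := hr t (hr' t (subset_itv_oo_cc ht)).
- apply: continuous_in_subspaceT => t /set_mem/= ht.
  by have [/is_derive1_continuous] := hr t (hr' t ht).
rewrite in_itv/= subr0 => /andP[t0 ts] e.
have [_ g0s] := hr s ltac:(by rewrite gtr0_norm).
by have := hs t t0 (ltW ts); nra.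
Qed.

End OneVariable.

(** * Mean value and Taylor estimates on sup-norm balls *)

Section SeveralVariables.
Context {R : realType} {n : nat}.
Implicit Types (f u : 'rV[R]_n -> R) (x y z p e : 'rV[R]_n) (W : set 'rV[R]_n).

Lemma norm_leP x (r : R) : 0 <= r -> reflect (forall i, `|x 0 i| <= r) (`|x| <= r).
Proof.
move=> r0; apply: (iffP idP) => [h i|h]; first exact: le_trans (coord_le_norm x i) h.
rewrite [leLHS]mx_normrE; apply/bigmax_leP; split=> // -[i j] _ /=.
by rewrite (ord1 i).
Qed.

Lemma norm_ltP x (r : R) : 0 < r -> reflect (forall i, `|x 0 i| < r) (`|x| < r).
Proof.
move=> r0; apply: (iffP idP) => [h i|h]; first exact: le_lt_trans (coord_le_norm x i) h.
rewrite [ltLHS]mx_normrE; apply/bigmax_ltP; split=> // -[i j] _ /=.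
by rewrite (ord1 i).
Qed.

Lemma is_derive_line f x e (t d : R) :
  is_derive (x + t *: e) e f d <-> is_derive t (1 : R) (fun s : R => f (x + s *: e)) d.
Proof.
have E : (fun h : R => h^-1 *: ((f \o shift (x + t *: e)) (h *: e) - f (x + t *: e))) =
   (fun h : R => h^-1 *: (((fun s : R => f (x + s *: e)) \o shift t) (h *: (1 : R)) - f (x + t *: e))).
  apply/funext => h /=; congr (_ *: (f _ - _)).
  by rewrite [h *: (1:R)]mulr1 scalerDl addrCA addrC.
split=> -[h1 h2]; split.
- by rewrite /derivable -E.
- by rewrite /derive -E.
- by rewrite /derivable E.
- by rewrite /derive E.
Qed.

Definition has_partials W f := forall x, W x -> forall i, derivable f x (delta_mx 0 i : 'rV[R]_n).

Definition sup_ball p (r : R) : set 'rV[R]_n := [set x | `|x - p| < r].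

(** The conditions |s| <= |t| and 0 <= s t say that s lies between 0 and t for either sign of t.
    Rescaling to [0, 1] treats both signs at once. *)
Lemma axis_mvt W f x i (t : R) :
  has_partials W f -> (forall s, `|s| <= `|t| -> 0 <= s * t -> W (x + s *: delta_mx 0 i)) ->
  exists s, [/\ `|s| <= `|t|, 0 <= s * t &
    f (x + t *: delta_mx 0 i) - f x = t * partial i f (x + s *: delta_mx 0 i)].
Proof.
move=> hf hW.
pose g (s : R) := f (x + (s * t) *: delta_mx 0 i).
have hg (s : R) : 0 <= s <= 1 -> is_derive s (1 : R) g (t * partial i f (x + (s * t) *: delta_mx 0 i)).
  move=> /andP[s0 s1].
  have /derivableP/is_derive_line h : derivable f (x + (s * t) *: delta_mx 0 i) (delta_mx 0 i : 'rV[R]_n).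
    apply: hf; apply: hW.
      by rewrite normrM ger0_norm// ler_piMl.
    by rewrite -mulrA mulr_ge0// -expr2 sqr_ge0.
  have ht : is_derive s (1 : R) (fun s : R => s * t) t.
    apply: is_derive_eq; rewrite /GRing.scale /=; ring.
  have := @is_derive1_comp _ (fun r : R => f (x + r *: delta_mx 0 i)) (fun r : R => r * t) s _ _ h ht.
  by rewrite mulrC.
have [||s hs e] := @MVT_segment _ g (fun s : R => t * partial i f (x + (s * t) *: delta_mx 0 i)) 0 1 ler01.
- by move=> s; rewrite in_itv/= => /andP[? ?]; apply: hg; rewrite !ltW.
- apply: continuous_in_subspaceT => s /set_mem/=; rewrite in_itv/= => hs.
  exact: is_derive1_continuous (hg s hs).
exists (s * t).
move: hs; rewrite in_itv/= => /andP[s0 s1].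
rewrite normrM ger0_norm// ler_piMl//; split=> //.
  by rewrite -mulrA mulr_ge0// -expr2 sqr_ge0.
by move: e; rewrite /g mul1r mul0r scale0r addr0 subr0 mulr1.
Qed.

(** Pass from x to y one coordinate at a time and telescope. A sup-norm ball is a box, so all the
    intermediate points remain in it. *)
Lemma sup_ball_mvt p r f x y :
  has_partials (sup_ball p r) f -> sup_ball p r x -> sup_ball p r y ->
  exists xi : 'I_n -> 'rV[R]_n,
    (forall i, sup_ball p r (xi i) /\ `|xi i - x| <= `|y - x|) /\
    f y - f x = \sum_i (y 0 i - x 0 i) * partial i f (xi i).
Proof.
move=> hf hx hy.
have r0 : 0 < r by apply: le_lt_trans hx.
pose z (m : nat) : 'rV[R]_n := \row_j (if (j < m)%N then y 0 j else x 0 j).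
have zS (i : 'I_n) : z i.+1 = z i + (y 0 i - x 0 i) *: delta_mx 0 i.
  apply/rowP => j; rewrite !mxE ltnS leq_eqVlt eqxx /=.
  case: (ltngtP j i) => [ji|ij|/val_inj ->].
  - by rewrite (_ : j == i = false) ?mulr0 ?addr0//; apply/eqP => e; rewrite e ltnn in ji.
  - by rewrite (_ : j == i = false) ?mulr0 ?addr0//; apply/eqP => e; rewrite e ltnn in ij.
  - by rewrite ?ltnn !eqxx /= mulr1 addrC subrK.
have hz (i : 'I_n) (s : R) : `|s| <= `|y 0 i - x 0 i| -> 0 <= s * (y 0 i - x 0 i) ->
    sup_ball p r (z i + s *: delta_mx 0 i) /\ `|z i + s *: delta_mx 0 i - x| <= `|y - x|.
  move=> h1 h2; split; last first.
    apply/norm_leP => // j; rewrite !mxE eqxx /=.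
    have hyx := coord_le_norm (y - x) j; rewrite !mxE in hyx.
    have [->|ji] := eqVneq j i.
      by rewrite ltnn mulr1 addrC addKr (le_trans h1)//; have := coord_le_norm (y - x) i; rewrite !mxE.
    by rewrite mulr0 addr0; case: ifP => _; rewrite ?subrr ?normr0.
  apply/norm_ltP => // j; rewrite !mxE eqxx /=.
  have /norm_ltP - /(_ r0 j) := hx; have /norm_ltP - /(_ r0 j) := hy; rewrite !mxE => hyj hxj.
  have [ji|ji] := eqVneq j i; last by rewrite mulr0 addr0; case: ifP.
  move: h1 h2 hyj hxj; rewrite ji ltnn mulr1.
  set a := y 0 i; set b := x 0 i; set c := p 0 i => h1 h2 ha hb.
  have [ab|ab] := leP b a.
    rewrite [X in _ <= X]ger0_norm ?subr_ge0// in h1.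
    have [e|ne] := eqVneq a b.
      by move: h1; rewrite e subrr normr_le0 => /eqP ->; rewrite addr0.
    have lt : 0 < a - b by rewrite subr_gt0 lt_neqAle eq_sym ne.
    rewrite pmulr_lge0// in h2; rewrite ger0_norm// in h1.
    by move: ha hb; rewrite !ltr_norml => /andP[? ?] /andP[? ?]; apply/andP; split; lra.
  have lt : a - b < 0 by rewrite subr_lt0.
  rewrite nmulr_lge0// in h2; rewrite ler0_norm// (ltr0_norm lt) in h1.
  by move: ha hb; rewrite !ltr_norml => /andP[? ?] /andP[? ?]; apply/andP; split; lra.
have hs (i : 'I_n) : exists s : R, [/\ `|s| <= `|y 0 i - x 0 i|, 0 <= s * (y 0 i - x 0 i) &
   f (z i.+1) - f (z i) = (y 0 i - x 0 i) * partial i f (z i + s *: delta_mx 0 i)].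
  rewrite zS; apply: (axis_mvt (sup_ball p r)) => // s h1 h2; exact: (hz i s h1 h2).1.
have [s hs'] := choice hs.
exists (fun i : 'I_n => z i + s i *: delta_mx 0 i); split.
  by move=> i; have [h1 h2 _] := hs' i; apply: hz.
transitivity (\sum_(i < n) (f (z i.+1) - f (z i))); last first.
  by apply: eq_bigr => i _; have [_ _ <-] := hs' i.
have z0 : z 0%N = x by apply/rowP => j; rewrite mxE.
have zn : z n = y by apply/rowP => j; rewrite mxE ltn_ord.
rewrite -{1}zn -{1}z0 -(telescope_sumr (fun m => f (z m)) (leq0n n)) big_mkord.
by [].
Qed.

Lemma lipschitz_of_partials p r f (C : R) x y :
  has_partials (sup_ball p r) f ->
  (forall z, sup_ball p r z -> forall i, `|partial i f z| <= C) ->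
  sup_ball p r x -> sup_ball p r y -> `|f y - f x| <= n%:R * C * `|y - x|.
Proof.
move=> hf hC hx hy; have [xi [hxi ->]] := sup_ball_mvt _ _ _ _ _ hf hx hy.
apply: le_trans (ler_norm_sum _ _ _) _.
rewrite -mulrA mulr_natl -[X in _ *+ X]card_ord -sumr_const ler_sum// => i _.
rewrite normrM mulrC ler_pM// ?hC//; first by have [] := hxi i.
by have := coord_le_norm (y - x) i; rewrite !mxE.
Qed.

(** Each first derivative in [sup_ball_mvt] is moved from [xi i] back to x, at a cost controlled by
    the second derivatives. *)
Lemma taylor2_of_partials p r f (C : R) x y :
  has_partials (sup_ball p r) f -> (forall i, has_partials (sup_ball p r) (partial i f)) ->
  (forall z, sup_ball p r z -> forall i j, `|partial i (partial j f) z| <= C) ->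
  sup_ball p r x -> sup_ball p r y ->
  `|f y - f x - \sum_i (y 0 i - x 0 i) * partial i f x| <= n%:R ^+ 2 * C * `|y - x| ^+ 2.
Proof.
move=> hf hff hC hx hy; have [xi [hxi ->]] := sup_ball_mvt _ _ _ _ _ hf hx hy.
rewrite -sumrB; apply: le_trans (ler_norm_sum _ _ _) _.
rewrite expr2 -!mulrA mulr_natl -[X in _ *+ X]card_ord -sumr_const ler_sum// => i _.
have [h1 h2] := hxi i.
have C0 : 0 <= C by apply: le_trans (hC x hx i i).
rewrite -mulrBr normrM; apply: (@le_trans _ _ (`|y - x| * (n%:R * C * `|y - x|))); last first.
  by rewrite le_eqVlt; apply/orP; left; apply/eqP; ring.
rewrite ler_pM//; first by have := coord_le_norm (y - x) i; rewrite !mxE.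
apply: le_trans (lipschitz_of_partials p r _ C _ _ (hff i) _ hx h1) _.
  by move=> z hz j; apply: hC.
by rewrite ler_wpM2l// mulr_ge0.
Qed.

Lemma sup_ball_sub W p : open W -> W p -> exists2 r, 0 < r & sup_ball p r `<=` W.
Proof.
move=> oW Wp; have /nbhs_normP[r /= r0 hr] := open_nbhs_nbhs (conj oW Wp).
by exists r => // x hx; apply: hr; rewrite /ball_/= distrC.
Qed.

Lemma open_sup_ball p r : open (sup_ball p r).
Proof.
rewrite (_ : sup_ball p r = ball p r); first exact: ball_open.
by rewrite -ball_normE; apply/seteqP; split => x /=; rewrite /ball_/= distrC.
Qed.

Lemma C_on_sub m W W' f : W' `<=` W -> C_on m W f -> C_on m W' f.
Proof.
elim: m f => [|m IH] f WW /= [h1 h2]; split; try by move=> x /WW/h1.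
  by [].
by move=> i; have [h3 h4] := h2 i; split; [move=> x /WW/h3 | apply: IH].
Qed.

Lemma C_on_pred m W f : C_on m.+1 W f -> C_on m W f.
Proof.
elim: m f => [|m IH] f [h1 h2]; first by [].
by split=> // i; have [h3 h4] := h2 i; split=> //; apply: IH.
Qed.

Lemma C1_has_partials m W f : C_on m.+1 W f -> has_partials W f.
Proof. by move=> [_ h] x Wx i; apply: (h i).1. Qed.

Lemma C_on_partial m W f i : C_on m.+1 W f -> C_on m W (partial i f).
Proof. by move=> [_ h]; exact: (h i).2. Qed.

Lemma C_on_continuous m W f x : C_on m W f -> W x -> {for x, continuous f}.
Proof. by case: m => [|m] [h _]; exact: h. Qed.

Lemma C1_is_derive W f x e : open W -> W x -> C_on 1 W f ->
  is_derive x e f (\sum_i e 0 i * partial i f x).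
Proof.
move=> oW Wx hf; set d := \sum_i _.
have [r r0 hr] := sup_ball_sub _ _ oW Wx.
suff : (h^-1 *: ((f \o shift x) (h *: e) - f x) @[h --> (0:R)^'] --> d).
  by move=> h; split; [apply/cvg_ex; exists d | exact: (cvg_lim (@Rhausdorff R))].
apply/cvgrPdist_lt => eps eps0.
have hp : has_partials (sup_ball x r) f := C1_has_partials _ _ _ (C_on_sub _ _ _ _ hr hf).
(* The error is at most n |e| eta, which must be below eps; the added 1 covers e = 0. *)
pose eta := eps / (n%:R * `|e| + 1).
have D0 : 0 < n%:R * `|e| + 1 by apply: ltr_wpDl; rewrite ?mulr_ge0.
have eta0 : 0 < eta by rewrite divr_gt0.
have [q q0 hq] : exists2 q, 0 < q & forall z, `|z - x| < q -> forall i, `|partial i f x - partial i f z| < eta.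
  have : \forall z \near x, forall i : 'I_n, `|partial i f x - partial i f z| < eta.
    have hi (i : 'I_n) : \forall z \near x, `|partial i f x - partial i f z| < eta.
      have := C_on_continuous _ _ _ _ (C_on_partial _ _ _ i hf) Wx.
      by move/cvgrPdist_lt => /(_ eta eta0).
    exact: filter_forall hi.
  by move=> /nbhs_normP[q /= q0 hq]; exists q => // z hz; apply: hq; rewrite /ball_/= distrC.
pose s := Num.min r q / (`|e| + 1).
have E0 : 0 < `|e| + 1 by apply: ltr_wpDl.
have s0 : 0 < s by rewrite divr_gt0// lt_min r0.
have : \forall h \near (0 : R)^', `|h| < s by apply: dnbhs0_lt.
have : \forall h \near (0 : R)^', h != 0 by rewrite near_withinE; exact: nearW.
apply: filterS2 => h h0 hs.
have he : `|h *: e| < Num.min r q.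
  rewrite normrZ; move: hs; rewrite /s ltr_pdivlMr// => hs; apply: le_lt_trans hs.
  by rewrite ler_wpM2l// lerDl.
move: he; rewrite lt_min => /andP[hr1 hq1].
have xx : sup_ball x r x by rewrite /sup_ball/= subrr normr0.
have hx' : sup_ball x r (h *: e + x) by rewrite /sup_ball/= addrK.
have [xi [hxi /= ->]] := sup_ball_mvt _ _ _ _ _ hp xx hx'.
have -> : d - h^-1 *: (\sum_i ((h *: e + x) 0 i - x 0 i) * partial i f (xi i)) =
   \sum_i e 0 i * (partial i f x - partial i f (xi i)).
  rewrite /d scaler_sumr -sumrB; apply: eq_bigr => i _.
  by rewrite !mxE /GRing.scale /=; field.
apply: le_lt_trans (ler_norm_sum _ _ _) _.
apply: (@le_lt_trans _ _ (n%:R * `|e| * eta)).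
  rewrite -mulrA mulr_natl -[X in _ *+ X]card_ord -sumr_const ler_sum// => i _.
  rewrite normrM ler_pM//; first exact: coord_le_norm.
  by apply/ltW/hq; have [_ h1] := hxi i; rewrite (le_lt_trans h1)// addrK.
by rewrite /eta mulrA ltr_pdivrMr// mulrC ltr_pM2l// ltrDl.
Qed.

Lemma C2_jet2 W f x e : open W -> W x -> C_on 2 W f ->
  jet2 (fun s : R => f (x + s *: e)) (fun s => \sum_i e 0 i * partial i f (x + s *: e))
    (quadform (hess f x) e).
Proof.
move=> oW Wx hf; split.
  have : \forall s \near (0 : R), W (x + s *: e).
    have c : (x + s *: e) @[s --> (0 : R)] --> x.
      rewrite -[X in _ --> X]addr0 -(scale0r e); apply: cvgD; first exact: cvg_cst.
      by apply: cvgZr_tmp; exact: cvg_id.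
    by apply: c; apply: open_nbhs_nbhs.
  apply: filterS => s Ws; apply/is_derive_line; apply: (C1_is_derive W) => //.
  exact: C_on_pred.
have h (i : 'I_n) : is_derive (0 : R) (1 : R) (fun s : R => e 0 i * partial i f (x + s *: e))
    (e 0 i * \sum_j e 0 j * partial j (partial i f) x).
  apply: is_deriveZ; have /is_derive_line : is_derive (x + (0:R) *: e) e (partial i f) (\sum_j e 0 j * partial j (partial i f) x); last by [].
  by rewrite scale0r addr0; apply: (C1_is_derive W) => //; exact: C_on_partial hf.
have := is_derive_sum h.
rewrite (_ : \sum_(i < n) _ = fun s => \sum_i e 0 i * partial i f (x + s *: e)); last first.
  by apply/funext => s; rewrite fct_sumE.
move/is_derive_eq; apply.
rewrite quadform_sum exchange_big /=; apply: eq_bigr => i _.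
by rewrite mulr_sumr; apply: eq_bigr => j _; rewrite mxE; ring.
Qed.

Lemma C2_locally_bounded W f p : open W -> W p -> C_on 2 W f ->
  exists r C, [/\ 0 < r, 0 < C, sup_ball p r `<=` W &
    forall x, sup_ball p r x -> [/\ `|f x| <= C, forall i, `|partial i f x| <= C &
      forall i j, `|partial i (partial j f) x| <= C]].
Proof.
move=> oW Wp hf; have [r0 r00 hr0] := sup_ball_sub _ _ oW Wp.
have bnd (g : 'rV[R]_n -> R) : {for p, continuous g} -> \forall C \near +oo, \forall x \near p, `|g x| <= C.
  move=> cg; exists (`|g p| + 1); split; first exact: num_real.
  move=> C hC; have /cvgrPdist_lt/(_ 1 ltr01) := cg; apply: filterS => x.
  by have := ler_normB (g p) (g p - g x); rewrite opprB addrC subrK; lra.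
have b0 := bnd f (C_on_continuous _ _ _ _ hf Wp).
have b1 (i : 'I_n) := bnd _ (C_on_continuous _ _ _ _ (C_on_partial _ _ _ i hf) Wp).
have b2 (ij : 'I_n * 'I_n) := bnd _ (C_on_continuous _ _ _ _ (C_on_partial _ _ _ ij.1 (C_on_partial _ _ _ ij.2 hf)) Wp).
have b1' : \forall C \near +oo, forall i : 'I_n, \forall x \near p, `|partial i f x| <= C.
  exact: filter_forall b1.
have b2' : \forall C \near +oo, forall ij : 'I_n * 'I_n,
  \forall x \near p, `|partial ij.1 (partial ij.2 f) x| <= C by exact: filter_forall b2.
have b3 : \forall C \near +oo, (0 : R) < C by exact: nbhs_pinfty_gt.
have [C [[c0 c1] [c2 C0]]] : exists C : R, ((\forall x \near p, `|f x| <= C) /\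
   (forall i : 'I_n, \forall x \near p, `|partial i f x| <= C)) /\
   ((forall ij : 'I_n * 'I_n, \forall x \near p, `|partial ij.1 (partial ij.2 f) x| <= C) /\ 0 < C).
  have := filter_ex (filterI (filterI b0 b1') (filterI b2' b3)).
  exact.
have c1' : \forall x \near p, forall i : 'I_n, `|partial i f x| <= C.
  exact: filter_forall c1.
have c2' : \forall x \near p, forall ij : 'I_n * 'I_n,
  `|partial ij.1 (partial ij.2 f) x| <= C by exact: filter_forall c2.
have c3 : \forall x \near p, ((`|f x| <= C) /\ (forall i : 'I_n, `|partial i f x| <= C)) /\
   (forall ij : 'I_n * 'I_n, `|partial ij.1 (partial ij.2 f) x| <= C).
  exact: filterI (filterI c0 c1') c2'.
have /nbhs_normP[r /= r1 hr] := c3.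
exists (Num.min r0 r), C; split => //; first by rewrite lt_min r00.
  by move=> x; rewrite /sup_ball/= lt_min => /andP[h _]; exact: hr0.
move=> x; rewrite /sup_ball/= lt_min => /andP[_ h].
have [[h1 h2] h3] : ((`|f x| <= C) /\ (forall i, `|partial i f x| <= C)) /\
   (forall ij : 'I_n * 'I_n, `|partial ij.1 (partial ij.2 f) x| <= C).
  by apply: hr; rewrite /ball_/= distrC.
by split=> // i j; exact: (h3 (i, j)).
Qed.

Lemma C2_family_locally_bounded (I : finType) (F : I -> 'rV[R]_n -> R) W p :
  open W -> W p -> (forall i, C_on 2 W (F i)) ->
  exists r C, [/\ 0 < r, 0 < C, sup_ball p r `<=` W &
    forall i x, sup_ball p r x -> [/\ `|F i x| <= C, forall j, `|partial j (F i) x| <= C &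
      forall j l, `|partial j (partial l (F i)) x| <= C]].
Proof.
move=> oW Wp hF.
have hi (i : I) : exists rC : R * R, [/\ 0 < rC.1, 0 < rC.2, sup_ball p rC.1 `<=` W &
    forall x, sup_ball p rC.1 x -> [/\ `|F i x| <= rC.2,
      forall j, `|partial j (F i) x| <= rC.2 &
      forall j l, `|partial j (partial l (F i)) x| <= rC.2]].
  by have [r [C h]] := C2_locally_bounded _ _ _ oW Wp (hF i); exists (r, C).
have [g hg] := choice hi.
have [r0 r00 hr0] := sup_ball_sub _ _ oW Wp.
pose r := \big[Num.min/r0]_i (g i).1.
pose C := \sum_i (g i).2 + 1.
have r_gt0 : 0 < r.
  by rewrite /r; elim/big_ind: _ => // [a b a0 b0|i _]; [rewrite lt_min a0|case: (hg i)].
have rle i : r <= (g i).1 by rewrite /r (bigD1 i)//= ge_min lexx.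
have rler0 : r <= r0.
  rewrite /r; elim/big_rec: _ => // i a _ ar; by rewrite ge_min ar orbT.
have g0 i : 0 <= (g i).2 by have [_ h _ _] := hg i; apply: ltW.
have Cge i : (g i).2 <= C.
  by rewrite /C (bigD1 i)//= -addrA lerDl addr_ge0//; apply: sumr_ge0.
exists r, C; split=> //.
- have S0 : 0 <= \sum_i (g i).2 by apply: sumr_ge0.
  by rewrite /C; lra.
- by move=> x hx; apply: hr0; apply: lt_le_trans hx rler0.
move=> i x hx; have [_ _ _ h] := hg i.
have [h1 h2 h3] := h x (lt_le_trans hx (rle i)).
by split=> [|j|j l]; apply: le_trans (Cge i).
Qed.

End SeveralVariables.

(** * Local geometry of E: defining functions, tangent spaces, nearest points *)

Section Submanifolds.
Context {R : realType} {n : nat}.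
Implicit Types (x y z p : 'rV[R]_n) (W E : set 'rV[R]_n) (F : 'rV[R]_n -> 'rV[R]_n).

(** Transposed with respect to the usual convention, so that the differential acts on row vectors by
    right multiplication. *)
Definition jacobian F x : 'M[R]_n := \matrix_(i, j) partial i (fun t => F t 0 j) x.

Lemma C2_map_estimates W F p : open W -> W p ->
  (forall i, C_on 2 W (fun x => F x 0 i)) ->
  exists r C, [/\ 0 < r, 0 < C, sup_ball p r `<=` W &
    forall x y, sup_ball p r x -> sup_ball p r y ->
      `|F y - F x| <= C * `|y - x| /\
      `|F y - F x - (y - x) *m jacobian F x| <= C * `|y - x| ^+ 2].
Proof.
move=> oW Wp hF.
have [r [C [r_gt0 C0 subW hb]]] := C2_family_locally_bounded _ _ _ _ oW Wp hF.
exists r, ((n%:R + n%:R ^+ 2 + 1) * C); split=> // [|x y hx hy].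
  by rewrite mulr_gt0// ltr_wpDl// addr_ge0.
have hp i : has_partials (sup_ball p r) (fun x => F x 0 i).
  exact: C1_has_partials (C_on_sub _ _ _ _ subW (hF i)).
have hpp i j : has_partials (sup_ball p r) (partial j (fun x => F x 0 i)).
  apply: C1_has_partials; apply: C_on_partial; exact: (C_on_sub _ _ _ _ subW (hF i)).
have n2 : (0 : R) <= n%:R ^+ 2 by rewrite sqr_ge0.
have n1 : (0 : R) <= n%:R by [].
have D0 : 0 <= (n%:R + n%:R ^+ 2 + 1) * C by apply: mulr_ge0; [lra | exact: ltW].
split.
- apply/norm_leP => [|i]; first exact: mulr_ge0.
  rewrite !mxE; apply: le_trans (lipschitz_of_partials _ _ _ C _ _ (hp i) _ hx hy) _.
    by move=> z hz j; have [_ h _] := hb i z hz.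
  by rewrite ler_wpM2r// ler_wpM2r ?(ltW C0)//; lra.
- apply/norm_leP => [|i]; first by apply: mulr_ge0 => //; exact: sqr_ge0.
  rewrite !mxE.
  have -> : \sum_j (y - x) 0 j * jacobian F x j i = \sum_j (y 0 j - x 0 j) * partial j (fun x => F x 0 i) x.
    by apply: eq_bigr => j _; rewrite !mxE.
  apply: le_trans (taylor2_of_partials _ _ _ C _ _ (hp i) (hpp i) _ hx hy) _.
    by move=> z hz j l; have [_ _ h] := hb i z hz.
  by rewrite ler_wpM2r ?sqr_ge0// ler_wpM2r ?(ltW C0)//; lra.
Qed.

(** Test with a small t of the same sign as g. Used to read a first-order condition off a minimum
    with quadratic errors. *)
Lemma eq0_of_quadratic_bound (g K tau : R) : 0 < tau -> 0 <= K ->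
  (forall t, `|t| < tau -> t * g <= K * t ^+ 2) -> g = 0.
Proof.
move=> tau0 K0 h; apply/eqP/negPn/negP => g0.
have ng : 0 < `|g| by rewrite normr_gt0.
pose t := Num.min (tau / 2) (`|g| / (2 * (K + 1))).
have t0 : 0 < t by rewrite lt_min !divr_gt0//; lra.
have t1 : t < tau by rewrite gt_min; apply/orP; left; lra.
have t2 : t * (2 * (K + 1)) <= `|g|.
  by rewrite -ler_pdivlMr ?ge_min ?lexx ?orbT//; lra.
have := h (Num.sg g * t); rewrite normrM normr_sg g0 mul1r gtr0_norm// => /(_ t1).
have -> : Num.sg g * t * g = t * `|g| by rewrite [in RHS]normrEsg; ring.
by rewrite exprMn sqr_sg g0 mul1r; nra.
Qed.

Lemma C_on_0 m W : C_on m W (fun _ : 'rV[R]_n => 0 : R).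
Proof.
elim: m => [|m IH] /=; split=> //.
- by move=> x _; exact: cst_continuous.
- by move=> x _; exact: cst_continuous.
move=> i; split; first by move=> x _; exact: derivable_cst.
rewrite (_ : partial i _ = fun=> 0)//.
by apply/funext => x; exact: derive_cst.
Qed.

Lemma norm_attained x : (0 < n)%N -> exists i, `|x| <= `|x 0 i|.
Proof.
move=> n0; pose i0 : 'I_n := Ordinal n0.
exists [arg max_(i > i0) `|x 0 i|]%O.
case: arg_maxP => // i _ hi.
by apply/norm_leP => // j; exact: hi.
Qed.

(** The constants r and C are uniform in the base point z0, because a nearest point moves with the
    contact point. The [y i] serve as smooth substitutes for the distance: one of them, depending on
    x, bounds it. The last clause is the normality of x - z0 when z0 is locally nearest to x. *)
Lemma submanifold_local_geometry (k : nat) E p :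
  (0 < n)%N -> (k <= n)%N -> smooth_submanifold k E -> E p ->
  exists r C (y : 'I_n -> 'rV[R]_n -> R), [/\ 0 < r, 0 < C,
   (forall i, C_on 2 (sup_ball p r) (y i)) /\
   (forall i z, E z -> sup_ball p r z -> y i z = 0),
   forall x, sup_ball p r x -> exists z i,
     [/\ E z, `|z - p| <= C * `|x - p| & `|x - z| <= C * `|y i x|] &
   forall z0, E z0 -> sup_ball p r z0 -> exists Q, [/\ orthoproj k Q,
     forall z, E z -> sup_ball p r z ->
       eucl_norm ((z - z0) *m (1%:M - Q)) <= C * sq (z - z0) &
     forall x s, 0 < s -> (forall z, E z -> `|z - z0| < s -> sq (x - z0) <= sq (x - z)) ->
       (x - z0) *m Q = 0]].
Proof.
move=> n0 kn hE Ep.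
have [W [V [phi [psi [[oW Wp oV] [sphi spsi] hphi hpsi hEW]]]]] := hE p Ep.
have Vq : V (phi p) by have [] := hphi p Wp.
have [r1 [C1 [r10 C10 subW est1]]] := C2_map_estimates _ _ _ oW Wp (sphi 2%N).
have [rho [C2 [rho0 C20 subV est2]]] := C2_map_estimates _ _ _ oV Vq (spsi 2%N).
set q := phi p in Vq est2 subV.
(* Halving leaves room: points of E near z0 and lines of length rho / 2 through [phi z0] stay where
   the estimates for phi and psi hold. *)
pose r := Num.min (r1 / 2) (rho / (2 * C1)).
have r0 : 0 < r by rewrite lt_min !divr_gt0// mulr_gt0.
have rr1 : r <= r1 / 2 by rewrite ge_min lexx.
have rrho : C1 * r <= rho / 2.
  have h : r <= rho / (2 * C1) by rewrite ge_min lexx orbT.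
  rewrite mulrC -ler_pdivlMr//; apply: le_trans h _.
  by rewrite le_eqVlt; apply/orP; left; apply/eqP; field; rewrite gt_eqF.
have sub1 x : sup_ball p r x -> sup_ball p r1 x.
  by rewrite /sup_ball/= => h; lra.
have pin : sup_ball p r1 p by rewrite /sup_ball/= subrr normr0.
have qin : sup_ball q rho q by rewrite /sup_ball/= subrr normr0.
have hph x : sup_ball p r x -> `|phi x - q| < rho / 2.
  move=> hx; have [h _] := est1 p x pin (sub1 x hx); apply: le_lt_trans h _.
  by apply: lt_le_trans rrho; rewrite ltr_pM2l.
have hph' x : sup_ball p r x -> sup_ball q rho (phi x).
  by move=> /hph; rewrite /sup_ball/=; lra.
have E0 z (i : 'I_n) : E z -> W z -> (k <= i)%N -> phi z 0 i = 0 by move=> Ez Wz; apply: (hEW z Wz).1.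
have Epsi eta : V eta -> (forall i : 'I_n, (k <= i)%N -> eta 0 i = 0) -> E (psi eta).
  by move=> Ve h; have [Wpsi e] := hpsi eta Ve; apply/(hEW _ Wpsi); rewrite e.
pose P : 'M[R]_(k, n) := pid_mx k.
have Pj (s : 'rV[R]_k) (j : 'I_n) : (k <= j)%N -> (s *m P) 0 j = 0.
  move=> kj; rewrite mxE big1// => i _; rewrite !mxE (_ : (i == j :> nat) = false) ?mulr0//.
  by apply/negbTE; rewrite neq_ltn (leq_trans (ltn_ord i) kj).
have Pinj (s : 'rV[R]_k) : s *m P = 0 -> s = 0.
  move=> h; have : s *m P *m (pid_mx k : 'M[R]_(n, k)) = s.
    by rewrite -mulmxA mul_pid_mx minnn (minn_idPr kn) pid_mx_1 mulmx1.
  by rewrite h mul0mx.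
(* In the chart, T drops the normal coordinates; psi (T (phi x)) is the point of E compared with
   x. *)
pose T (x : 'rV[R]_n) : 'rV[R]_n := \row_j (if (j < k)%N then x 0 j else 0).
have Psurj (x : 'rV[R]_n) : (forall j : 'I_n, (k <= j)%N -> x 0 j = 0) -> exists s : 'rV[R]_k, s *m P = x.
  move=> h; exists (x *m (pid_mx k : 'M[R]_(n, k))).
  rewrite -mulmxA mul_pid_mx !minnn; apply/rowP => j; rewrite mxE (bigD1 j)//= mxE eqxx /=.
  rewrite big1 ?addr0 => [|i ij]; last first.
    by rewrite mxE (_ : (i == j :> nat) = false) ?mulr0//; apply/negbTE.
  by case: ltnP => [_|/h ->]; rewrite ?mulr1 ?mul0r.
pose yy (i : 'I_n) (x : 'rV[R]_n) := if (k <= i)%N then phi x 0 i else 0.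
pose C := 1 + C1 * C2 + C2 + n%:R * C2 * C1 ^+ 2.
have C1C2 : 0 < C1 * C2 by rewrite mulr_gt0.
have nC : 0 <= n%:R * C2 * C1 ^+ 2.
  by apply: mulr_ge0 (sqr_ge0 _); apply: mulr_ge0 => //; exact: ltW.
exists r, C, yy; split=> //.
- by rewrite /C; lra.
- split=> [i|i z Ez hz]; rewrite /yy; case ki: (k <= i)%N => //.
  + exact: (C_on_sub 2 W _ _ (fun x hx => subW x (sub1 x hx)) (sphi 2%N i)).
  + exact: C_on_0.
  + exact: (E0 z i Ez (subW _ (sub1 _ hz)) ki).
- move=> x hx; have hT : sup_ball q rho (T (phi x)).
    apply/norm_ltP => // j; have := hph' x hx => /norm_ltP - /(_ rho0 j).
    rewrite !mxE; case: ltnP => // kj _.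
    by rewrite /q (E0 p j Ep Wp kj) subrr normr0.
  have [i hi] := norm_attained (phi x - T (phi x)) n0.
  exists (psi (T (phi x))), i.
  have [Vx ex] := hphi x (subW _ (sub1 _ hx)).
  have [_ ep] := hphi p Wp.
  have Ez : E (psi (T (phi x))).
    by apply: Epsi; [exact: subV | move=> j kj; rewrite mxE ltnNge kj].
  split=> //.
  + have [h _] := est2 q _ qin hT; rewrite {1}/q ep in h.
    apply: le_trans h _; have [h' _] := est1 p x pin (sub1 x hx).
    apply: (@le_trans _ _ (C2 * (C1 * `|x - p|))); last first.
      by rewrite mulrA ler_wpM2r// /C; lra.
    rewrite ler_pM2l//; apply: le_trans h'.
    apply/norm_leP => [|j]; first exact: normr_ge0.
     have := coord_le_norm (phi x - phi p) j; rewrite !mxE.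
    case: ltnP => kj //; rewrite /q (E0 p j Ep Wp kj) subrr normr0 => _.
    exact: normr_ge0.
  + have [h _] := est2 _ _ hT (hph' x hx); rewrite ex in h; apply: le_trans h _.
    apply: (@le_trans _ _ (C2 * `|yy i x|)); last by rewrite ler_wpM2r// /C; lra.
    rewrite ler_pM2l//; apply: le_trans hi _; rewrite !mxE /yy.
    by case: (ltnP i k) => _; rewrite ?subrr ?subr0 lexx.
- move=> z0 Ez0 hz0.
  have [Vz ez] := hphi z0 (subW _ (sub1 _ hz0)).
  set eta := phi z0 in Vz ez.
  have heta := hph' _ hz0; have heta2 := hph _ hz0.
  (* The rows of A span the tangent space of E at z0, as images of the first k coordinate vectors
     under the differential of psi. *)
  pose A := P *m jacobian psi eta.
  have etaE (s : 'rV[R]_k) (t : R) (i : 'I_n) : (k <= i)%N -> (eta + t *: (s *m P)) 0 i = 0.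
    by move=> ki; rewrite mxE [X in _ + X]mxE Pj// mulr0 addr0; apply: E0 (subW _ (sub1 _ hz0)) ki.
  have hline (s : 'rV[R]_k) (t : R) : `|t *: (s *m P)| < rho / 2 ->
      [/\ E (psi (eta + t *: (s *m P))), phi (psi (eta + t *: (s *m P))) = eta + t *: (s *m P),
       `|psi (eta + t *: (s *m P)) - z0| <= C2 * `|t *: (s *m P)| &
       `|psi (eta + t *: (s *m P)) - z0 - t *: (s *m A)| <= C2 * `|t *: (s *m P)| ^+ 2].
    move=> ht; have hb : sup_ball q rho (eta + t *: (s *m P)).
      rewrite /sup_ball/= addrAC; apply: le_lt_trans (ler_normD _ _) _.
      by rewrite -/eta in heta2; lra.
    have ee : eta + t *: (s *m P) - eta = t *: (s *m P) by rewrite addrAC subrr add0r.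
    have [h1 h2] := est2 _ _ heta hb; rewrite ez ee in h1 h2.
    have [Wb eb] := hpsi _ (subV _ hb).
    split=> //; first by apply: Epsi; [exact: subV | exact: etaE].
    suff -> : t *: (s *m A) = t *: (s *m P) *m jacobian psi eta by [].
    by rewrite /A mulmxA -scalemxAl.
  (* If s A = 0, a chart displacement of length m moves psi by at most C2 m^2, while phi is
     C1-Lipschitz and undoes it: m <= C1 C2 m^2. The third bound on m excludes this; the first two
     keep the points in range. *)
  have Ainj (s : 'rV[R]_k) : s *m A = 0 -> s = 0.
    move=> sA; apply: Pinj; apply/eqP/negPn/negP => sP.
    have nsP : 0 < `|s *m P| by rewrite normr_gt0.
    pose m := Num.min (Num.min (rho / 4) (r1 / (4 * C2))) (1 / (2 * (C1 * C2))).
    have m0 : 0 < m by rewrite !lt_min !divr_gt0 ?mulr_gt0.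
    have m1 : m <= rho / 4 by rewrite !ge_min lexx.
    have m2 : m * (4 * C2) <= r1.
      by rewrite -ler_pdivlMr ?mulr_gt0// !ge_min lexx orbT.
    have m3 : m * (2 * (C1 * C2)) <= 1.
      by rewrite -ler_pdivlMr ?mulr_gt0// !ge_min lexx orbT.
    have nm : `|(m / `|s *m P|) *: (s *m P)| = m.
      by rewrite normrZ normrM normfV normr_id (gtr0_norm m0) divfK// gt_eqF.
    have [_ e1 e2 e3] := hline s (m / `|s *m P|) ltac:(rewrite nm; lra).
    rewrite nm sA scaler0 subr0 in e2 e3.
    set zt := psi _ in e1 e2 e3.
    have hzt : sup_ball p r1 zt.
      rewrite /sup_ball/= -(subrK z0 zt) -addrA; apply: le_lt_trans (ler_normD _ _) _.
      by move: hz0; rewrite /sup_ball/=; nra.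
    have [h _] := est1 _ _ (sub1 _ hz0) hzt.
    rewrite e1 -/eta addrAC subrr add0r nm in h.
    have : C1 * `|zt - z0| <= C1 * (C2 * m ^+ 2) by rewrite ler_pM2l.
    by nra.
  have [Q [hQ hQA hQ0]] := orthoproj_of_rows _ _ Ainj.
  exists Q; split=> //.
  + move=> z Ez hz; have hphz := hph' _ hz.
    have [Vz' ez'] := hphi z (subW _ (sub1 _ hz)).
    have [s hs] : exists s : 'rV[R]_k, s *m P = phi z - eta.
      apply: Psurj => j kj; rewrite !mxE (E0 z j Ez (subW _ (sub1 _ hz)) kj).
      by rewrite /eta (E0 z0 j Ez0 (subW _ (sub1 _ hz0)) kj) subrr.
    have [_ h2] := est2 _ _ heta hphz; rewrite ez' ez in h2.
    rewrite -/eta -hs -mulmxA -/A in h2.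
    set err := z - z0 - s *m A in h2.
    have -> : (z - z0) *m (1%:M - Q) = err *m (1%:M - Q).
      have eA : s *m A *m (1%:M - Q) = 0 by rewrite mulmxBr mulmx1 hQA subrr.
      by rewrite /err [RHS]mulmxBl eA subr0.
    have le1 : eucl_norm (err *m (1%:M - Q)) <= eucl_norm err.
      rewrite !eucl_normE ler_wsqrtr// (orthoproj_pythagoras k Q err hQ).
      by rewrite lerDr sq_ge0.
    apply: le_trans le1 _; apply: le_trans (eucl_norm_le _) _.
    have [h1 _] := est1 _ _ (sub1 _ hz0) (sub1 _ hz); rewrite -/eta -hs in h1.
    have h3 : `|s *m P| ^+ 2 <= C1 ^+ 2 * sq (z - z0).
      apply: (@le_trans _ _ ((C1 * `|z - z0|) ^+ 2)); first by rewrite lerXn2r// nnegrE// mulr_ge0// ltW.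
      by rewrite exprMn ler_wpM2l ?sqr_ge0// norm_le_sq.
    have sq0' := sq_ge0 (z - z0).
    apply: (@le_trans _ _ (n%:R * (C2 * (C1 ^+ 2 * sq (z - z0))))); last first.
      rewrite /C !mulrDl (_ : n%:R * _ = n%:R * C2 * C1 ^+ 2 * sq (z - z0)); last by ring.
      by rewrite lerDr; rewrite !addr_ge0// ?mulr_ge0// ltW.
    by rewrite ler_wpM2l// (le_trans h2)// ler_pM2l.
  + move=> x s s0 hx; apply: hQ0 => v.
    set m := x - z0.
    pose N := `|v *m P| + 1.
    have N0 : 0 < N by rewrite ltr_wpDl.
    pose tau := Num.min (rho / 2 / N) (s / (C2 * N)).
    have tau0 : 0 < tau by rewrite lt_min !divr_gt0 ?mulr_gt0.
    (* Minimality gives 2 m.w <= |w|^2 for the displacement w along E. The first summand bounds the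
       deviation of w from t (v A), the second bounds |w|^2 / 2. *)
    pose K := (eucl_norm m * (n%:R * (C2 * N ^+ 2)) + n%:R ^+ 2 * (C2 * N) ^+ 2 / 2).
    have K0 : 0 <= K.
      have n1 : 0 <= n%:R :> R by [].
      by apply: addr_ge0; repeat first [exact: sqr_ge0 | exact: eucl_norm_ge0 | exact: ltW | exact: n1 | apply: mulr_ge0].
    apply: (@eq0_of_quadratic_bound _ K tau) => // t ht.
    have ht1 : `|t| * N < rho / 2.
      by rewrite -ltr_pdivlMr//; apply: lt_le_trans ht _; rewrite ge_min lexx.
    have ht2 : `|t| * (C2 * N) < s.
      by rewrite -ltr_pdivlMr ?mulr_gt0//; apply: lt_le_trans ht _; rewrite ge_min lexx orbT.
    have nt : `|t *: (v *m P)| <= `|t| * N by rewrite normrZ ler_wpM2l// /N lerDl.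
    have [e0 _ e2 e3] := hline v t (le_lt_trans nt ht1).
    set zt := psi _ in e0 e2 e3.
    have dz : `|zt - z0| <= `|t| * (C2 * N).
      by apply: le_trans e2 _; rewrite mulrCA ler_pM2l.
    have := hx zt e0 (le_lt_trans dz ht2).
    have -> : x - zt = m - (zt - z0) by rewrite /m opprB addrA subrK.
    rewrite -/m; set w := zt - z0; rewrite [X in _ <= X -> _]sqB => h1.
    set err := w - t *: (v *m A) in e3.
    have dE : dot m w = t * dot m (v *m A) + dot m err.
      by rewrite /err dotDr dotNr dotZr; ring.
    have b1 : `|dot m err| <= eucl_norm m * (n%:R * (C2 * N ^+ 2)) * t ^+ 2.
      apply: le_trans (normr_dot_le _ _) _; rewrite -mulrA ler_wpM2l ?eucl_norm_ge0//.
      apply: le_trans (eucl_norm_le _) _; rewrite -mulrA ler_wpM2l//.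
      apply: le_trans e3 _; rewrite -mulrA ler_pM2l//.
      rewrite -[t ^+ 2]real_normK ?num_real// mulrC -exprMn lerXn2r// nnegrE// mulr_ge0//.
      exact: ltW.
    have b2 : sq w <= n%:R ^+ 2 * (C2 * N) ^+ 2 * t ^+ 2.
      apply: le_trans (sq_le_norm _) _; rewrite -mulrA ler_wpM2l ?sqr_ge0//.
      have -> : (C2 * N) ^+ 2 * t ^+ 2 = (`|t| * (C2 * N)) ^+ 2.
        by rewrite [RHS]exprMn real_normK ?num_real// mulrC.
      have rhs0 := le_trans (normr_ge0 _) dz.
      by apply: lerXn2r; rewrite ?nnegrE.
    move: b1; rewrite ler_norml => /andP[b1 _].
    rewrite dE in h1; rewrite /K mulrDl.
    set X := eucl_norm m * _ * _ in b1 *; set Y := n%:R ^+ 2 * _ in b2 *.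
    have -> : Y / 2 * t ^+ 2 = Y * t ^+ 2 / 2 by ring.
    lra.
Qed.

End Submanifolds.

(** * Minima on compact sets and derivatives at a contact point *)

Section Contact.
Context {R : realType} {n : nat}.
Implicit Types (f u v y : 'rV[R]_n -> R) (x z p e : 'rV[R]_n) (W : set 'rV[R]_n) (M : 'M[R]_n).

Lemma compact_superlevel (I : Type) p (r : R) (b : I -> 'rV[R]_n -> R) :
  (forall i x, `|x - p| <= r -> {for x, continuous (b i)}) ->
  compact [set x | `|x - p| <= r /\ forall i, 0 <= b i x].
Proof.
move=> cb; apply: bounded_closed_compact.
  exists (`|p| + r); split; first exact: num_real.
  move=> N hN x /= [hx _]; have := ler_normD (x - p) p; rewrite subrK; lra.
move=> x clx.
have cn : {for x, continuous (fun t : 'rV[R]_n => `|t - p|)}.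
  have h : (t - p) @[t --> x] --> x - p.
    by apply: (@continuousB _ _ _ id (cst p) x); [move=> A hA | exact: cst_continuous].
  exact: (cvg_norm h).
have xr : `|x - p| <= r.
  rewrite leNgt; apply/negP => rx.
  have /clx[t [/= [ht _] ht2]] : \forall t \near x, r < `|t - p| by exact: (cvgr_gt _ cn _ rx).
  by move: ht2; rewrite ltNge ht.
split=> // i; rewrite leNgt; apply/negP => rx.
have /clx[t [/= [_ ht] ht2]] : \forall t \near x, b i t < 0.
  exact: (cvgr_lt _ (cb i x xr) _ rx).
by move: ht2; rewrite ltNge ht.
Qed.

Lemma compact_min (A : set 'rV[R]_n) f : A !=set0 -> compact A ->
  (forall x, A x -> {for x, continuous f}) ->
  exists2 c, A c & forall t, A t -> f c <= f t.
Proof.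
move=> A0 cA cf; have [|c /set_mem Ac hc] := compact_EVT_min A0 cA (f := f).
  by apply: continuous_in_subspaceT => x /set_mem; exact: cf.
by exists c => // t At; apply: hc; exact: mem_set.
Qed.

Lemma compact_pos_lower_bound (A : set 'rV[R]_n) f : compact A ->
  (forall x, A x -> {for x, continuous f}) -> (forall x, A x -> 0 < f x) ->
  exists2 m, 0 < m & forall x, A x -> m <= f x.
Proof.
move=> cA cf f0; have [-> |/set0P A0] := eqVneq A set0; first by exists 1.
by have [c Ac hc] := compact_min _ _ A0 cA cf; exists (f c); [exact: f0 | exact: hc].
Qed.

(** Collects all smallness conditions on one constant into a list of pairs (A, B), each demanding r
    |A| <= B. *)
Lemma ex_small (s : seq (R * R)) : all (fun ab => 0 < ab.2) s ->
  exists2 r, 0 < r & forall ab, ab \in s -> r * `|ab.1| <= ab.2.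
Proof.
elim: s => [_|[a b] s IH /= /andP[b0 /IH[r r0 hr]]]; first by exists 1.
have d0 : 0 < `|a| + 1 by rewrite ltr_wpDl.
exists (Num.min r (b / (`|a| + 1))); first by rewrite lt_min r0 divr_gt0.
move=> ab; rewrite inE => /predU1P[->|/hr] /=.
  apply: (@le_trans _ _ (b / (`|a| + 1) * `|a|)).
    by rewrite ler_wpM2r// ge_min lexx orbT.
  by rewrite mulrAC ler_pdivrMr// ler_pM2l// lerDl.
by apply: le_trans; rewrite ler_wpM2r// ge_min lexx.
Qed.

Lemma quadform_line M x e (s : R) : symmx M ->
  quadform M (x + s *: e) = quadform M x + 2 * dot (x *m M) e * s + quadform M e * s ^+ 2.
Proof.
move=> sM; rewrite !quadformE mulmxDl dotDl !dotDr -!scalemxAl !dotZl !dotZr.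
have -> : dot (e *m M) x = dot (x *m M) e by rewrite dot_mull sM dotC.
ring.
Qed.

Lemma continuous_sum_real (T : topologicalType) (I : finType) (F : I -> T -> R) (t : T) :
  (forall i, {for t, continuous (F i)}) -> {for t, continuous (fun s => \sum_i F i s)}.
Proof. by move=> h; apply: (cvg_big add_continuous) => i _; exact: h. Qed.

Lemma continuous_quadform M : continuous (quadform M).
Proof.
move=> x; rewrite (_ : quadform M = fun t => \sum_i \sum_j t 0 i * t 0 j * M i j); last first.
  by apply/funext => t; exact: quadform_sum.
apply: continuous_sum_real => i; apply: continuous_sum_real => j.
apply: (@continuousM _ _ (fun t : 'rV[R]_n => t 0 i * t 0 j) (cst (M i j))); last exact: cst_continuous.
by apply: (@continuousM _ _ (fun t : 'rV[R]_n => t 0 i) (fun t => t 0 j)); exact: coord_continuous.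
Qed.

Lemma sum_delta_mx (F : 'I_n -> R) i : \sum_j (delta_mx 0 i : 'rV[R]_n) 0 j * F j = F i.
Proof.
rewrite (bigD1 i)//= mxE !eqxx mul1r big1 ?addr0// => j ji.
by rewrite mxE (negPf ji) andbF mul0r.
Qed.

Lemma near_line x e (P : set 'rV[R]_n) : (\forall z \near x, P z) ->
  \forall s \near (0 : R), P (x + s *: e).
Proof.
move=> hP; have c : (x + s *: e) @[s --> (0 : R)] --> x.
  rewrite -[X in _ --> X]addr0 -(scale0r e); apply: cvgD; first exact: cvg_cst.
  by apply: cvgZr_tmp; exact: cvg_id.
exact: c.
Qed.

(** The second-derivative test along every line through x0; unit directions give the gradient
    identity. *)
Lemma contact_derivatives W u v y p x0 M (eps kap : R) : open W -> W x0 -> symmx M ->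
  C_on 2 W u -> C_on 2 W v -> C_on 2 W y ->
  let f x := u x - v x - eps * (quadform M (x - p) + kap * y x) in
  (\forall x \near x0, f x0 <= f x) ->
  (forall i, partial i u x0 - partial i v x0 =
     eps * (2 * ((x0 - p) *m M) 0 i + kap * partial i y x0)) /\
  (forall e, eps * (2 * quadform M e + kap * quadform (hess y x0) e) <=
     quadform (hess u x0) e - quadform (hess v x0) e).
Proof.
move=> oW Wx sM hu hv hy f hmin.
have J e := jet2B _ _ _ _ _ _ (jet2B _ _ _ _ _ _ (C2_jet2 _ _ _ e oW Wx hu) (C2_jet2 _ _ _ e oW Wx hv))
  (jet2Z eps _ _ _ (jet2D _ _ _ _ _ _
     (jet2_quadratic (quadform M (x0 - p)) (2 * dot ((x0 - p) *m M) e) (quadform M e))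
     (jet2Z kap _ _ _ (C2_jet2 _ _ _ e oW Wx hy)))).
have T e : (\sum_i e 0 i * partial i u x0 - \sum_i e 0 i * partial i v x0 -
     eps * (2 * dot ((x0 - p) *m M) e + kap * \sum_i e 0 i * partial i y x0) = 0) /\
    0 <= quadform (hess u x0) e - quadform (hess v x0) e -
     eps * (2 * quadform M e + kap * quadform (hess y x0) e).
  have [|h1 h2] := jet2_min _ _ _ (J e).
    have := near_line x0 e _ hmin; apply: filterS => s /=.
    by rewrite /f scale0r addr0 (addrAC x0 _ (- p)) quadform_line// !mulr0 expr0n /= mulr0 !addr0.
  by split=> //; move: h1; rewrite /= scale0r addr0 mulr0 addr0.
split=> [i|e]; last by have [_] := T e; rewrite subr_ge0.
have [+ _] := T (delta_mx 0 i); rewrite !sum_delta_mx dotC dotE sum_delta_mx.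
by move/eqP; rewrite subr_eq0 => /eqP.
Qed.

End Contact.

(** * Algebra of a contact point under Property P_k *)

Section LinearGrowth.
Context {R : realType} {n : nat}.
Implicit Types (x z p e : 'rV[R]_n) (M N Q : 'M[R]_n) (U : set 'M[R]_n).

Lemma closure_symmx U : U `<=` symmx -> closure U `<=` symmx.
Proof.
move=> hU M clM; apply/matrixP => i j; rewrite mxE; apply/eqP/negPn/negP => ne.
pose d := `|M j i - M i j|.
have d0 : 0 < d by rewrite normr_gt0 subr_eq0.
have hn : \forall t \near M, `|M - t| < d / 2.
  by apply/nbhs_normP; exists (d / 2) => //=; rewrite divr_gt0.
have [t [Ut ht]] := clM _ hn.
have e : t j i = t i j by rewrite -[in RHS](hU t Ut) mxE.
have h1 := mx_coord_le (M - t) j i; have h2 := mx_coord_le (M - t) i j.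
rewrite !mxE in h1 h2.
have : d <= `|M j i - t j i| + `|M i j - t i j|.
  rewrite /d e; apply: le_trans (ler_normB _ _).
  by rewrite le_eqVlt; apply/orP; left; apply/eqP; congr (`|_|); ring.
by move: ht => /=; lra.
Qed.

Lemma locally_lipschitz_near (L : 'rV[R]_n * R * 'rV[R]_n -> 'M[R]_n) q0 :
  locally_lipschitz L -> exists rho Lam, [/\ 0 < rho, 0 < Lam &
    forall q q', `|q - q0| < rho -> `|q' - q0| < rho -> `|L q - L q'| <= Lam * `|q - q'|].
Proof.
move=> hL; have [W /nbhs_normP[rho /= rho0 hW] [A [_ hA]]] := hL q0.
exists rho, (`|A| + 1); split=> //.
move=> q q' hq hq'; apply: (hA (`|A| + 1) _ (q, q')) => /=.
  by have := ler_norm A; lra.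
by split; apply: hW; rewrite /ball_/= distrC.
Qed.

Lemma norm_mulmx_coord_le x M (a : R) j : (forall i l, `|M i l| <= a) ->
  `|(x *m M) 0 j| <= n%:R * `|x| * a.
Proof.
move=> ha; rewrite mxE; apply: le_trans (ler_norm_sum _ _ _) _.
rewrite -mulrA mulr_natl -[X in _ *+ X]card_ord -sumr_const ler_sum// => i _.
by rewrite normrM ler_pM// coord_le_norm.
Qed.

Lemma sq_le_small x (r : R) : `|x| <= r -> r <= 1 -> sq x <= n%:R ^+ 2 * r.
Proof.
move=> hx r1; apply: le_trans (sq_le_norm x) _; rewrite ler_wpM2l ?sqr_ge0//.
have := normr_ge0 x; rewrite expr2; move: `|x| hx => t ht t0; nra.
Qed.

Lemma quadform_small M (a r : R) x : (0 < n)%N -> (forall i j, `|M i j| <= a) ->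
  `|x| <= r -> r <= 1 ->
  `|quadform M x| <= 2 * a * n%:R ^+ 3 * r /\
  forall i, `|2 * (x *m M) 0 i| <= 2 * a * n%:R ^+ 3 * r.
Proof.
move=> n0 ha hx r1.
have nn1 : (1 : R) <= n%:R by rewrite ler1n.
have a0 : 0 <= a by apply: le_trans (ha (Ordinal n0) (Ordinal n0)).
have r0 : 0 <= r by apply: le_trans hx.
have b := quadform_le M a x ha; have g i := norm_mulmx_coord_le x M a i ha.
have s := sq_le_small x r hx r1.
have ar : 0 <= a * r by rewrite mulr_ge0.
split=> [|i].
  apply: le_trans b _; apply: (@le_trans _ _ (a * n%:R * (n%:R ^+ 2 * r))).
    by rewrite ler_wpM2l// mulr_ge0.
  have : 0 <= (a * r) * n%:R ^+ 3 by rewrite mulr_ge0// exprn_ge0.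
  rewrite !exprS expr0; move: (n%:R : R) => N; lra.
rewrite normrM ger0_norm//.
have h2 : n%:R * `|x| * a <= n%:R * r * a by rewrite ler_wpM2r// ler_wpM2l.
have h3 : n%:R <= n%:R ^+ 3 :> R by rewrite -{1}[n%:R]expr1; apply: ler_weXn2l.
have h4 : n%:R * (a * r) <= n%:R ^+ 3 * (a * r) by rewrite ler_wpM2r.
have := g i; clear -h2 h4; lra.
Qed.

Lemma quadform_tilted (k : nat) Q (d : R) e : orthoproj k Q ->
  quadform ((1 - d)%:M - Q) e = (1 - d) * sq e - sq (e *m Q).
Proof. by move=> hQ; rewrite quadformB quadform_scalar (orthoproj_quadform _ _ _ hQ). Qed.

(** Applied to z = (point of E) - p: the normal part of z is quadratic in z, so its square is of
    fourth order and half of -d |z|^2 absorbs it. *)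
Lemma quadform_tilted_neg (k : nat) Q (C0 r d : R) z : orthoproj k Q -> 0 < C0 ->
  `|z| <= r -> r <= 1 -> r * (C0 ^+ 2 * n%:R ^+ 2) <= d / 2 ->
  eucl_norm (z *m (1%:M - Q)) <= C0 * sq z ->
  quadform ((1 - d)%:M - Q) z <= - (d / 2) * sq z.
Proof.
move=> hQ C00 hz r1 hr ht.
have py := orthoproj_pythagoras _ _ z hQ; rewrite (quadform_tilted _ _ _ _ hQ).
have s0 := sq_ge0 z.
have ht2 : sq (z *m (1%:M - Q)) <= (C0 * sq z) ^+ 2.
  by rewrite -sqr_eucl_norm lerXn2r// nnegrE ?eucl_norm_ge0// mulr_ge0// ltW.
have h2 : C0 ^+ 2 * sq z <= C0 ^+ 2 * (n%:R ^+ 2 * r).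
  by rewrite ler_wpM2l ?sqr_ge0//; exact: sq_le_small.
have h3 : C0 ^+ 2 * sq z <= d / 2 by clear -h2 hr; lra.
have h4 : sq z * (C0 ^+ 2 * sq z) <= sq z * (d / 2) by rewrite ler_wpM2l.
by rewrite exprMn expr2 in ht2; clear -h4 ht2 py; lra.
Qed.

(* With N = (1 - Q) - delta Q, the contact inequality makes
   (- Hv + Lv) - (- Hu + Lu) - eps N positive definite. *)
Lemma contact_contradiction (k : nat) U Q (Hu Hv Hy Lu Lv : 'M[R]_n)
    (delta epsb eps CM d kap B1 B2 B3 B4 : R) :
  (k <= n)%N -> U `<=` symmx -> (forall M N, U M -> posdefmx N -> U (M + N)) ->
  orthoproj k Q -> 0 < delta ->
  (forall (eps : R) M N, 0 < eps < epsb -> closure U M -> loewner_le M CM%:M -> symmx N ->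
      (forall i, (1 <= i <= k)%N -> lambda N i = - delta) ->
      (forall j, (k.+1 <= j <= n)%N -> lambda N j = 1) -> U (M + eps *: N)) ->
  0 < eps < epsb -> eps <= 1 ->
  closure U (- Hu + Lu) -> (symmx `\` U) (- Hv + Lv) ->
  (forall e, eps * (2 * quadform ((1 - d)%:M - Q) e + kap * quadform Hy e) <=
     quadform Hu e - quadform Hv e) ->
  (forall e, `|kap * quadform Hy e| <= B1 * sq e) ->
  (forall e, `|quadform (Lu - Lv) e| <= eps * B2 * sq e) ->
  (forall e, `|quadform Lu e| <= B3 * sq e) ->
  (forall e, `|quadform Hv e| <= B4 * sq e) ->
  B3 + B4 + 1 <= CM -> 2 * d + B1 <= 1 -> 2 * d + B1 + B2 < 1 ->
  2 * d + B1 + B2 < delta -> False.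
Proof.
move=> kn Usym Umono hQ delta0 hP /andP[eps0 epsb1] eps1 cu [sv nUv] hc hy hL hLu hHv b1 b2 b3 b4.
pose N : 'M[R]_n := 1%:M - (1 + delta) *: Q.
have [sN N1 N2] := lambda_orthoproj _ _ _ hQ delta0 kn.
have qN e : quadform N e = sq e - (1 + delta) * sq (e *m Q).
  by rewrite quadformB quadform1 quadformZ (orthoproj_quadform _ _ _ hQ).
have su : symmx (- Hu + Lu) := closure_symmx _ Usym _ cu.
have qmin e : sq (e *m Q) <= sq e.
  by rewrite (orthoproj_pythagoras _ _ e hQ) lerDl sq_ge0.
(* The contact inequality bounds -Hu by -Hv + eps, so the cap CM required by Property P_k comes from
   data of v and L alone. *)
have leC : loewner_le (- Hu + Lu) CM%:M.
  split; first by apply: symmxD; [exact: symmx_scalar | exact: symmxN].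
  move=> e; rewrite quadformB quadform_scalar subr_ge0 quadformD quadformN.
  have := hc e; rewrite (quadform_tilted _ _ _ _ hQ).
  have := hLu e; have := hHv e; have := hy e; rewrite !ler_norml => /andP[+ _] /andP[+ _] /andP[_ +].
  have := qmin e; have := sq_ge0 e.
  move: (quadform Hu e) (quadform Hv e) (quadform Lu e) (kap * quadform Hy e) (sq e) (sq (e *m Q)).
  clear -eps0 eps1 b1 b2 => hu hv lu y s q s0 qs h1 h2 h3 h4.
  have h5 : - s <= 2 * ((1 - d) * s - q) + y by nra.
  have h6 : eps * (- s) <= eps * (2 * ((1 - d) * s - q) + y) by rewrite ler_wpM2l// ltW.
  have h7 : eps * s <= s by rewrite -[leRHS]mul1r ler_wpM2r.
  have h8 : (B3 + B4 + 1) * s <= CM * s by rewrite ler_wpM2r.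
  clear -h2 h3 h4 h6 h7 h8; lra.
have UN := hP eps _ _ ltac:(by rewrite eps0) cu leC sN N1 N2.
apply: nUv.
have -> : - Hv + Lv = - Hu + Lu + eps *: N + (- Hv + Lv - (- Hu + Lu + eps *: N)).
  by rewrite [RHS]addrC subrK.
apply: Umono UN _; split.
  by apply: symmxD => //; apply: symmxN; apply: symmxD => //; exact: symmxZ.
move=> e e0; have : 0 < sq e by rewrite sq_gt0.
rewrite quadformB !quadformD quadformZ qN !quadformN.
have := hc e; rewrite (quadform_tilted _ _ _ _ hQ).
have := hL e; rewrite quadformB; have := hy e; rewrite !ler_norml => /andP[+ _] /andP[_ +].
have := qmin e; have := sq_ge0 (e *m Q).
move: (quadform Hu e) (quadform Hv e) (quadform Lu e) (quadform Lv e) (kap * quadform Hy e) (sq e) (sq (e *m Q)).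
clear -eps0 b3 b4 => hu hv lu lv y s q q0 qs h1 h2 h3 s0.
set c := 2 * d + B1 + B2 in b3 b4.
(* s - q and q are the normal and tangential parts of |e|^2; c collects all errors and is below both
   1 and delta. *)
have pos : 0 < (s - q) * (1 - c) + q * (delta - c).
  have [q0'|q0'] := ltP 0 q.
    have : 0 < q * (delta - c) by rewrite mulr_gt0// subr_gt0.
    have : 0 <= (s - q) * (1 - c) by rewrite mulr_ge0// subr_ge0// ltW.
    clear; lra.
  have -> : q = 0 by apply: le_anti; rewrite q0' q0.
  by rewrite mul0r addr0 subr0 mulr_gt0// subr_gt0.
have h4 : (s - q) * (1 - c) + q * (delta - c) <=
    2 * ((1 - d) * s - q) + y - B2 * s - (s - (1 + delta) * q).
  by rewrite /c; clear -h1; lra.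
have h5 : 0 < eps * (2 * ((1 - d) * s - q) + y - B2 * s - (s - (1 + delta) * q)).
  by rewrite mulr_gt0//; apply: lt_le_trans h4.
clear -h5 h2 h3; lra.
Qed.

End LinearGrowth.

(** * Linear growth of u - v away from E *)

Section LinearGrowthNearPoint.
Context {R : realType} {n : nat}.
Implicit Types (x z p e : 'rV[R]_n) (M N Q : 'M[R]_n) (U : set 'M[R]_n).

(** The bound is proved for each |y_i| separately, because the index that controls the distance to E
    varies with x. The constants are fixed in the order CM, delta, d, kap, r, m0, eps. *)
Lemma linear_growth (k : nat) (Omega E : set 'rV[R]_n) U
    (L : 'rV[R]_n * R * 'rV[R]_n -> 'M[R]_n) (u v : 'rV[R]_n -> R)
    p Q (r0 C0 : R) (y : 'I_n -> 'rV[R]_n -> R) :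
  (0 < n)%N -> (k <= n)%N -> open Omega -> closed E -> E `<=` Omega -> E p ->
  U `<=` symmx ->
  (forall M N, U M -> posdefmx N -> U (M + N)) ->
  property_P k U -> (forall q, symmx (L q)) -> locally_lipschitz L ->
  C_on 2 (Omega `\` E) u -> C_on 2 Omega v ->
  (forall x, (Omega `\` E) x -> closure U (Atilde L u x)) ->
  (forall x, Omega x -> (symmx `\` U) (Atilde L v x)) ->
  (forall x, (Omega `\` E) x -> v x < u x) ->
  orthoproj k Q -> 0 < r0 -> 0 < C0 ->
  (forall i, C_on 2 (sup_ball p r0) (y i)) ->
  (forall i z, E z -> sup_ball p r0 z -> y i z = 0) ->
  (forall z, E z -> sup_ball p r0 z ->
     eucl_norm ((z - p) *m (1%:M - Q)) <= C0 * sq (z - p)) ->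
  exists r eps kap M, [/\ 0 < r, 0 < eps, 0 < kap, symmx M &
    forall x, `|x - p| <= r -> ~ E x -> forall i,
      eps * (quadform M (x - p) + kap * `|y i x|) <= u x - v x].
Proof.
move=> n0 kn oO clE EO Ep Usym Umono UP Lsym Llip hu hv hAu hAv huv hQ r00 C00 hy hy0 htan.
have Op : Omega p by exact: EO.
have oD : open (Omega `\` E) by rewrite setDE; apply: openI => //; exact: closed_openC.
have [rv [Cv [rv0 Cv0 subO hvb]]] := C2_locally_bounded _ _ _ oO Op hv.
have pr0 : sup_ball p r0 p by rewrite /sup_ball/= subrr normr0.
have [ry [Cy [ry0 Cy0 suby hyb]]] := C2_family_locally_bounded _ _ _ _ (open_sup_ball p r0) pr0 hy.
pose q0 := (p, v p, grad v p).
have [rho [Lam [rho0 Lam0 hLam]]] := locally_lipschitz_near L q0 Llip.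
pose nn : R := n%:R.
have nn1 : 1 <= nn by rewrite /nn ler1n.
have nn0 : 0 <= nn by rewrite /nn.
pose CL := `|L q0| + Lam * rho.
have CL0 : 0 <= CL by apply: addr_ge0 => //; apply: mulr_ge0; exact: ltW.
(* CL bounds L on the Lipschitz neighbourhood and Cv bounds Hess v; the 1 pays for the eps term.
   None of these involves kap, r or eps, so delta is available before those choices. *)
pose CM := CL * nn + Cv * nn + 1.
have CM0 : 0 < CM.
  have h1 : 0 <= Cv * nn by apply: mulr_ge0 => //; exact: ltW.
  have h2 : 0 <= CL * nn by apply: mulr_ge0.
  by rewrite /CM; clear -h1 h2; lra.
have [delta [epsb [delta0 epsb0 hP]]] := UP CM CM0.
(* The budget for all errors: they must stay below 1 in normal and below delta in tangential
   directions. It is spent in eighths. *)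
pose mu := Num.min 1 delta.
have mu0 : 0 < mu by rewrite lt_min ltr01.
have mu1 : mu <= 1 by rewrite ge_min lexx.
have mud : mu <= delta by rewrite ge_min lexx orbT.
pose d := mu / 8.
have d0 : 0 < d by rewrite divr_gt0.
pose M : 'M[R]_n := (1 - d)%:M - Q.
have sM : symmx M by case: hQ => sQ _ _; apply: symmxD; [exact: symmx_scalar | exact: symmxN].
pose Cw := 2 * `|M| * nn ^+ 3.
have Cw0 : 0 <= Cw by apply: mulr_ge0; [apply: mulr_ge0 | exact: exprn_ge0].
have [kap kap0 hkap] := ex_small [:: (nn * Cy * (1 + Lam), mu / 8)] ltac:(by rewrite /= andbT divr_gt0).
have {hkap} kapE : kap * nn * Cy + kap * nn * Cy * Lam <= mu / 8.
  have := hkap _ (mem_head _ _); have := ler_norm (nn * Cy * (1 + Lam)).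
  move=> /= h1 h2; apply: le_trans h2; apply: le_trans (ler_wpM2l (ltW kap0) h1).
  by rewrite le_eqVlt; apply/orP; left; apply/eqP; ring.
have kn0 : 0 <= kap * nn * Cy by apply: mulr_ge0; [apply: mulr_ge0|] => //; exact: ltW.
have knL0 : 0 <= kap * nn * Cy * Lam by apply: mulr_ge0 => //; exact: ltW.
have kCy : kap * Cy <= kap * nn * Cy.
  by rewrite ler_wpM2r ?(ltW Cy0)// ler_peMr// ltW.
have kCy0 : 0 <= kap * Cy by apply: mulr_ge0; exact: ltW.
(* The first three pairs keep the ball inside the charts, those with rho keep the arguments of L in
   its Lipschitz neighbourhood, the one with C0 makes the quadratic part negative on E, and those
   with Cw make it small. *)
have [r rgt0 hr] := ex_small [:: (2, r0); (2, rv); (2, ry); (1, 1); (nn * Cv * 4, rho);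
   (C0 ^+ 2 * nn ^+ 2, d / 2); (Cw * 8, 1); (Cw * nn * Lam * 8, mu); (4, rho)]
   ltac:(by rewrite /= r00 rv0 ry0 ltr01 rho0 mu0 divr_gt0).
have hr' A B (h : (A, B) \in _) : r * A <= B :=
  le_trans (ler_wpM2l (ltW rgt0) (ler_norm A)) (hr (A, B) h).
have r1 := hr' 2 r0 ltac:(by rewrite !inE eqxx ?orbT).
have r2 := hr' 2 rv ltac:(by rewrite !inE eqxx ?orbT).
have r3 := hr' 2 ry ltac:(by rewrite !inE eqxx ?orbT).
have r4 := hr' 1 1 ltac:(by rewrite !inE eqxx ?orbT).
have r5 := hr' 4 rho ltac:(by rewrite !inE eqxx ?orbT).
have r6 := hr' (nn * Cv * 4) rho ltac:(by rewrite !inE eqxx ?orbT).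
have r7 := hr' (C0 ^+ 2 * nn ^+ 2) (d / 2) ltac:(by rewrite !inE eqxx ?orbT).
have r8 := hr' (Cw * 8) 1 ltac:(by rewrite !inE eqxx ?orbT).
have r9 := hr' (Cw * nn * Lam * 8) mu ltac:(by rewrite !inE eqxx ?orbT).
rewrite mulr1 in r4.
have cball x s : `|x - p| <= r -> r * 2 <= s -> sup_ball p s x.
  by rewrite /sup_ball/= => h1 h2; clear -h1 h2 rgt0; lra.
have inO x : `|x - p| <= r -> Omega x by move=> h; apply: subO; exact: cball h r2.
have iny x : `|x - p| <= r -> sup_ball p r0 x by move=> h; exact: cball h r1.
have small x (hx : `|x - p| <= r) := quadform_small M `|M| r (x - p) n0 (mx_coord_le M) hx r4.
have qMb x : `|x - p| <= r -> quadform M (x - p) <= Cw * r.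
  by move=> /small[h _]; apply: le_trans (ler_norm _) h.
pose Ys (x : 'rV[R]_n) := \sum_i `|y i x|.
have Yi i x : `|y i x| <= Ys x by rewrite /Ys (bigD1 i)//= lerDl sumr_ge0.
have yC x i : `|x - p| <= r -> `|y i x| <= Cy.
  by move=> hx; have [h _ _] := hyb i x (cball x ry hx r3).
have YC x : `|x - p| <= r -> Ys x <= nn * Cy.
  by move=> hx; rewrite mulr_natl -[X in _ *+ X]card_ord -sumr_const ler_sum// => i _; exact: yC.
have cy i x : `|x - p| <= r -> {for x, continuous (y i)}.
  by move=> hx; apply: C_on_continuous (hy i) _; exact: iny.
have cY x : `|x - p| <= r -> {for x, continuous Ys}.
  move=> hx; apply: (continuous_sum_real _ _ (fun i t => `|y i t|)) => i.
  exact: (cvg_norm (cy i x hx)).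
have csub x : {for x, continuous (fun t : 'rV[R]_n => t - p)}.
  by apply: (@continuousB _ _ _ id (cst p) x); [move=> A hA | exact: cst_continuous].
have cqM x : {for x, continuous (fun t : 'rV[R]_n => quadform M (t - p))}.
  exact: (@continuous_comp _ _ _ (fun t : 'rV[R]_n => t - p) (quadform M) x (csub x) (continuous_quadform M _)).
have cuv x : (Omega `\` E) x -> {for x, continuous (fun t : 'rV[R]_n => u t - v t)}.
  move=> hx; apply: continuousB; first exact: C_on_continuous hu hx.
  by apply: C_on_continuous hv _; case: hx.
have Eneg z : E z -> `|z - p| <= r -> quadform M (z - p) <= - (d / 2) * sq (z - p).
  move=> Ez hz; exact: (quadform_tilted_neg k _ C0 r d _ hQ C00 hz r4 r7 (htan z Ez (iny z hz))).
pose bS (i : bool) (x : 'rV[R]_n) := if i then `|x - p| - r else quadform M (x - p) + kap * Ys x.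
(* The part of the sphere |x - p| = r where the comparison function can be nonnegative. It avoids E,
   so u - v has a positive minimum m0 there. *)
pose S := [set x : 'rV[R]_n | `|x - p| <= r /\ forall i : bool, 0 <= bS i x].
have cS : compact S.
  apply: compact_superlevel => -[] x hx.
    apply: (@continuousB _ _ _ (fun t : 'rV[R]_n => `|t - p|) (cst r)); last exact: cst_continuous.
    exact: (cvg_norm (csub x)).
  apply: (@continuousD _ _ _ (fun t : 'rV[R]_n => quadform M (t - p)) (fun t => kap * Ys t)); first exact: cqM.
  by apply: (@continuousM _ _ (cst kap) Ys); [exact: cst_continuous | exact: cY].
have SE x : S x -> (Omega `\` E) x.
  move=> [hx hS]; split; first exact: inO.
  move=> Ex; have h1 := hS false; have h2 := hS true; rewrite /bS /= in h1 h2.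
  have Y0 : Ys x = 0 by rewrite /Ys big1// => i _; rewrite (hy0 i x Ex (iny x hx)) normr0.
  have h3 := Eneg x Ex hx; rewrite Y0 mulr0 addr0 in h1.
  have h4 : 0 < sq (x - p).
    by apply: lt_le_trans (norm_le_sq _); rewrite exprn_gt0//; clear -h2 rgt0; lra.
  by clear -h1 h3 h4 d0; nra.
have uvS x : S x -> 0 < u x - v x by move=> hx; rewrite subr_gt0; apply: huv; exact: SE.
have [m0 m00 hm0] := compact_pos_lower_bound _ _ cS (fun x hx => cuv x (SE x hx)) uvS.
have [eps eps0 heps] := ex_small [:: (2, 1); (2, rho); (2, epsb); (Cw * r + kap * (nn * Cy), m0)]
   ltac:(by rewrite /= ltr01 rho0 epsb0 m00).
have he A B (h : (A, B) \in _) : eps * A <= B :=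
  le_trans (ler_wpM2l (ltW eps0) (ler_norm A)) (heps (A, B) h).
have e1 := he 2 1 ltac:(by rewrite !inE eqxx ?orbT).
have e2 := he 2 rho ltac:(by rewrite !inE eqxx ?orbT).
have e3 := he 2 epsb ltac:(by rewrite !inE eqxx ?orbT).
have e4 := he (Cw * r + kap * (nn * Cy)) m0 ltac:(by rewrite !inE eqxx ?orbT).
clear he heps hr' hr.
exists r, eps, kap, M; split=> // x1 hx1 Ex1 i; rewrite leNgt; apply/negP => neg.
(* The sign makes the smooth function kap' y_i agree with kap |y_i| at x1. *)
pose kap' := kap * Num.sg (y i x1).
have kapn : `|kap'| <= kap.
  by rewrite normrM (gtr0_norm kap0) -[leRHS]mulr1 ler_wpM2l ?(ltW kap0)// normr_sg; case: (y i x1 == 0).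
pose b (x : 'rV[R]_n) := quadform M (x - p) + kap' * y i x.
pose f (x : 'rV[R]_n) := u x - v x - eps * b x.
have bY x : b x <= quadform M (x - p) + kap * Ys x.
  by rewrite lerD2l; apply: le_trans (ler_norm _) _; rewrite normrM ler_pM.
have f1 : f x1 < 0.
  by rewrite /f /b /kap' -mulrA -normrEsg; clear -neg; lra.
pose nu := - f x1.
have nu0 : 0 < nu by rewrite /nu oppr_gt0.
have cb x : `|x - p| <= r -> {for x, continuous b}.
  move=> hx; apply: (@continuousD _ _ _ (fun t : 'rV[R]_n => quadform M (t - p)) (fun t => kap' * y i t)); first exact: cqM.
  by apply: (@continuousM _ _ (cst kap') (y i)); [exact: cst_continuous | exact: cy].
(* Off A, u > v forces f > -nu = f x1, so the minimum over A is a local minimum of f. On E near p, b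
   <= 0, hence A stays away from E, where u is not controlled. *)
pose A := [set x : 'rV[R]_n | `|x - p| <= r /\ forall _ : unit, 0 <= b x - nu / eps].
have cA : compact A.
  apply: (compact_superlevel _ _ _ (fun _ x => b x - nu / eps)) => _ x hx.
  by apply: (@continuousB _ _ _ b (cst (nu / eps))); [exact: cb | exact: cst_continuous].
have Ab x : A x -> nu <= eps * b x.
  by move=> [_ /(_ tt)]; rewrite subr_ge0 ler_pdivrMr// mulrC.
have AE x : A x -> (Omega `\` E) x.
  move=> Ax; have h := Ab x Ax; case: Ax => hx _; split; first exact: inO.
  move=> Ex; have h1 := Eneg x Ex hx; rewrite /b (hy0 i x Ex (iny x hx)) mulr0 addr0 in h.
  have h2 : quadform M (x - p) <= 0.
    by apply: le_trans h1 _; rewrite mulNr oppr_le0 mulr_ge0 ?sq_ge0// ltW// divr_gt0.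
  by move: (lt_le_trans nu0 h); rewrite pmulr_rgt0// ltNge h2.
have Ax1 : A x1.
  split=> // _; rewrite subr_ge0 ler_pdivrMr//.
  have : v x1 < u x1 by apply: huv; split=> //; exact: inO.
  by rewrite /nu /f; clear; lra.
have cf x : A x -> {for x, continuous f}.
  move=> Ax; apply: (@continuousB _ _ _ (fun t : 'rV[R]_n => u t - v t) (fun t => eps * b t)); first exact: cuv (AE x Ax).
  by apply: (@continuousM _ _ (cst eps) b); [exact: cst_continuous | case: Ax => hx _; exact: cb].
have [x0 Ax0 minx0] := compact_min _ _ (ex_intro _ x1 Ax1) cA cf.
have Dx0 := AE x0 Ax0; have bx0 := Ab x0 Ax0.
have uv0 : v x0 < u x0 := huv x0 Dx0.
have fx0 : f x0 < 0 by apply: le_lt_trans f1; exact: minx0.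
have hx0r : `|x0 - p| <= r by case: Ax0.
have hx0 : `|x0 - p| < r.
  rewrite lt_neqAle hx0r andbT; apply/eqP => xr.
  have [ge0|lt0] := leP 0 (quadform M (x0 - p) + kap * Ys x0).
    have Sx0 : S x0 by split=> // -[]//; rewrite /bS xr subrr.
    have h1 := hm0 x0 Sx0.
    have h2 : b x0 <= Cw * r + kap * (nn * Cy).
      by apply: le_trans (bY x0) _; rewrite lerD ?qMb// ler_wpM2l ?YC// ltW.
    have h3 : eps * b x0 <= eps * (Cw * r + kap * (nn * Cy)) by rewrite ler_wpM2l// ltW.
    by move: fx0; rewrite /f; clear -h1 h3 e4; lra.
  by have := bY x0; clear -lt0 bx0 nu0 eps0; nra.
have near0 : \forall x \near x0, f x0 <= f x.
  have n1 : \forall x \near x0, (Omega `\` E) x by apply: open_nbhs_nbhs.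
  have n2 : \forall x \near x0, `|x - p| < r.
    exact: (open_nbhs_nbhs (conj (open_sup_ball p r) hx0)).
  near=> x.
  have hxr : `|x - p| < r by near: x.
  have hD : (Omega `\` E) x by near: x.
  have [ge|lt] := leP (nu / eps) (b x).
    by apply: minx0; split; [exact: ltW | move=> _; rewrite subr_ge0].
  have h1 := minx0 x1 Ax1; have h2 := huv x hD.
  rewrite ltr_pdivlMr// in lt.
  apply: (le_trans h1); have -> : f x1 = - nu by rewrite /nu opprK.
  by rewrite [f x]/f; clear -lt h2; clearbody nu; lra.
pose W := (Omega `\` E) `&` sup_ball p r0.
have oW : open W by apply: openI => //; exact: open_sup_ball.
have Wx0 : W x0 by split=> //; exact: iny.
have WO : W `<=` Omega by move=> x [[]].
have WD : W `<=` Omega `\` E by move=> x [].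
have WB : W `<=` sup_ball p r0 by move=> x [].
have [grad0 hess0] := contact_derivatives _ _ _ _ _ _ _ eps kap' oW Wx0 sM
  (C_on_sub _ _ _ _ WD hu)
  (C_on_sub _ _ _ _ WO hv)
  (C_on_sub _ _ _ _ WB (hy i)) near0.
have Ox0 : Omega x0 by case: Dx0.
(* At x0 both u - v and its gradient are at most eps m, so the two values of L differ by at most eps
   Lam m: an error proportional to eps, as [contact_contradiction] requires. *)
pose m := Cw * r + kap * Cy.
have [yb0 yb1 yb2] := hyb i x0 (cball x0 ry hx0r r3).
have val : `|u x0 - v x0| <= eps * m.
  rewrite ger0_norm; last by rewrite subr_ge0 ltW.
  apply: (@le_trans _ _ (eps * b x0)); first by move: fx0; rewrite /f; clear; lra.
  rewrite ler_wpM2l ?(ltW eps0)// /b /m lerD ?qMb//.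
  by apply: le_trans (ler_norm _) _; rewrite normrM ler_pM.
have em0 : 0 <= eps * m by apply: le_trans (normr_ge0 _) val.
have gval : `|grad u x0 - grad v x0| <= eps * m.
  apply/norm_leP => // j; rewrite !mxE grad0 normrM gtr0_norm// ler_wpM2l ?(ltW eps0)//.
  apply: le_trans (ler_normD _ _) _; rewrite lerD//; first by have [_] := small x0 hx0r.
  by rewrite normrM ler_pM.
have em : eps * m <= rho / 4.
  have : m <= 1 / 4 by rewrite /m; clear -r8 kCy kapE knL0 mu1; lra.
  move=> h; apply: le_trans (ler_wpM2l (ltW eps0) h) _; clear -e2 eps0; lra.
have vlip (g : 'rV[R]_n -> R) : has_partials (sup_ball p rv) g ->
    (forall z, sup_ball p rv z -> forall j, `|partial j g z| <= Cv) -> `|g x0 - g p| <= rho / 4.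
  move=> hg hgb.
  have pv : sup_ball p rv p by rewrite /sup_ball/= subrr normr0.
  have h1 := lipschitz_of_partials _ _ _ _ _ _ hg hgb pv (cball x0 rv hx0r r2).
  have h2 : n%:R * Cv * `|x0 - p| <= nn * Cv * r.
    by rewrite ler_wpM2l//; apply: mulr_ge0 => //; exact: ltW.
  clear -h1 h2 r6; lra.
have v0 : `|v x0 - v p| <= rho / 4.
  apply: vlip; first exact: C1_has_partials (C_on_sub _ _ _ _ subO hv).
  by move=> z hz j; have [_ h _] := hvb z hz.
have v1 : `|grad v x0 - grad v p| <= rho / 4.
  apply/norm_leP => [|j]; first by clear -rho0; lra.
  rewrite !mxE; apply: vlip.
    by apply: C1_has_partials; apply: C_on_partial; exact: (C_on_sub _ _ _ _ subO hv).
  by move=> z hz l; have [_ _ h] := hvb z hz.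
pose qu := (x0, u x0, grad u x0); pose qv := (x0, v x0, grad v x0).
have pn (q q' : 'rV[R]_n * R * 'rV[R]_n) (c : R) : `|q.1.1 - q'.1.1| <= c -> `|q.1.2 - q'.1.2| <= c ->
   `|q.2 - q'.2| <= c -> `|q - q'| <= c.
  by move=> h1 h2 h3; rewrite prod_normE /= prod_normE /= !ge_max h1 h2 h3.
have xp : `|x0 - p| <= rho / 4 by clear -hx0r r5; lra.
have hqv : `|qv - q0| < rho.
  by apply: (@le_lt_trans _ _ (rho / 4)); [exact: pn | clear -rho0; lra].
have hqu : `|qu - q0| < rho.
  apply: (@le_lt_trans _ _ (rho / 2)); last by clear -rho0; lra.
  apply: pn => /=; first by clear -xp rho0; lra.
    have := ler_normD (u x0 - v x0) (v x0 - v p); rewrite addrA subrK; clear -val v0 em; lra.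
  have := ler_normD (grad u x0 - grad v x0) (grad v x0 - grad v p).
  rewrite addrA subrK => h; apply: le_trans h _; apply: le_trans (lerD gval v1) _.
  by clear -em; lra.
have hL1 : `|L qu - L qv| <= eps * (Lam * m).
  rewrite mulrCA; apply: le_trans (hLam _ _ hqu hqv) _; rewrite ler_wpM2l ?(ltW Lam0)//.
  by apply: pn => //=; rewrite subrr normr0.
have hL2 : `|L qu| <= CL.
  have p0 : `|q0 - q0| < rho by rewrite subrr normr0.
  have h := hLam _ _ hqu p0.
  have h2 : Lam * `|qu - q0| <= Lam * rho by rewrite ler_wpM2l// ltW.
  have := ler_normD (L qu - L q0) (L q0); rewrite subrK /CL; clear -h h2; lra.
have [vb0 vb1 vb2] := hvb x0 (cball x0 rv hx0r r2).
apply: (contact_contradiction k U Q (hess u x0) (hess v x0) (hess (y i) x0) (L qu) (L qv)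
  delta epsb eps CM d kap' (kap * nn * Cy) (Lam * m * nn) (CL * nn) (Cv * nn)) => //.
- by rewrite eps0 /=; clear -e3 eps0; lra.
- by clear -e1 eps0; lra.
- exact: hAu.
- exact: hAv.
- move=> e; rewrite normrM (mulrAC kap) -!mulrA ler_pM//.
  by rewrite !mulrA; apply: quadform_le => j l; rewrite mxE.
- move=> e; rewrite !mulrA -(mulrA eps); apply: quadform_le => j l.
  exact: le_trans (mx_coord_le _ _ _) hL1.
- by move=> e; apply: quadform_le => j l; apply: le_trans (mx_coord_le _ _ _) hL2.
- by move=> e; apply: quadform_le => j l; rewrite mxE.
- by clear -kapE knL0 mu1; rewrite /d; lra.
- have h : Lam * m * nn <= mu / 8 + kap * nn * Cy * Lam.
    by rewrite /m; clear -r9; lra.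
  by clear -kapE knL0 mu1 mu0 h; rewrite /d; lra.
- have h : Lam * m * nn <= mu / 8 + kap * nn * Cy * Lam.
    by rewrite /m; clear -r9; lra.
  by clear -kapE knL0 mud mu0 h; rewrite /d; lra.
Unshelve. all: by end_near.
Qed.

End LinearGrowthNearPoint.

(** * The logarithmic barrier as a function of the squared distance *)

Section LogBarrier.
Context {R : realType}.
Implicit Types (K tau lam s t : R).

(* Applied to the squared distance t = d ^+ 2, this is K d^2 + tau (2 ln d + lam d). *)
Definition barrier K tau lam t : R := K * t + tau * (ln t + lam * Num.sqrt t).

Definition barrier' K tau lam t : R := K + tau * (t^-1 + lam * (2 * Num.sqrt t)^-1).

Lemma is_derive_barrier K tau lam t : 0 < t ->
  is_derive t (1 : R) (barrier K tau lam) (barrier' K tau lam t).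
Proof.
move=> t0; have h1 := is_derive1_ln t0; have h2 := is_derive1_sqrt t0.
have h3 := is_deriveD (is_deriveZ K (is_derive_id t (1 : R)))
  (is_deriveZ tau (is_deriveD h1 (is_deriveZ lam h2))).
by apply: is_derive_eq h3 _; rewrite /GRing.scale /= mulr1.
Qed.

Lemma is_derive_barrier' K tau lam (rho : R) : 0 < rho ->
  is_derive (rho ^+ 2) (1 : R) (barrier' K tau lam)
    (- (tau * ((rho ^+ 4)^-1 + lam * (4 * rho ^+ 3)^-1))).
Proof.
move=> rho0; have t0 : 0 < rho ^+ 2 by rewrite exprn_gt0.
have sr : Num.sqrt (rho ^+ 2) = rho by rewrite sqrtr_sqr gtr0_norm.
have h2 := is_derive1_sqrt t0; rewrite sr in h2.
have n1 : id (rho ^+ 2) != 0 by rewrite gt_eqF.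
have n2 : (2 \*: (@Num.sqrt R)) (rho ^+ 2) != 0 by rewrite /GRing.scale /= sr mulf_neq0// gt_eqF.
have h3 := is_deriveD (is_derive_cst K (rho ^+ 2) (1 : R))
  (is_deriveZ tau (is_deriveD (@is_deriveV _ id _ _ _ n1 (is_derive_id (rho ^+ 2) (1 : R)))
     (is_deriveZ lam (@is_deriveV _ (2 \*: (@Num.sqrt R)) _ _ _ n2 (is_deriveZ 2 h2))))).
apply: is_derive_eq h3 _; rewrite /GRing.scale /= sr.
by rewrite /GRing.scale /=; field; rewrite gt_eqF.
Qed.

(** Monotonicity allows the squared distance to be replaced by a smooth lower bound that agrees with
    it at the contact point, without losing the minimum. *)
Lemma ler_barrier K tau lam s t : 0 <= K -> 0 <= tau -> 0 <= lam -> 0 < s -> s <= t ->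
  barrier K tau lam s <= barrier K tau lam t.
Proof.
move=> K0 tau0 lam0 s0 st; rewrite /barrier lerD ?ler_wpM2l// lerD ?ler_wpM2l ?ler_wsqrtr//.
by rewrite ler_ln// posrE// (lt_le_trans s0).
Qed.

End LogBarrier.

(** * Eigenvalue sums of the barrier and lower bounds for the squared distance *)

Section BarrierContact.
Context {R : realType} {n : nat}.
Implicit Types (x z p e h m : 'rV[R]_n) (H B M Q : 'M[R]_n).

(* The rotationally invariant part of the barrier is borderline for sums of
   k + 2 eigenvalues; the error terms are absorbed by lam d. *)
Lemma barrier_trace_pos (k : nat) H B Q m (C b K tau c : R) :
  (k.+2 <= n)%N -> symmx H -> orthoproj k Q -> m != 0 -> 0 <= C ->
  0 <= tau -> b = 8 * C * eucl_norm m -> b * k%:R <= 2^-1 -> 0 <= K ->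
  let lam := 32 * C * k%:R in let rho := eucl_norm m in
  (forall e, - (tau * ((rho ^+ 4)^-1 + lam * (4 * rho ^+ 3)^-1)) * (2 * dot m e) ^+ 2 +
     barrier' K tau lam (rho ^+ 2) * (2 * (sq (e *m (1%:M - Q)) - b * sq (e *m Q))) <=
     quadform H e - quadform B e) ->
  (forall e, `|quadform B e| <= c * sq e) -> c * k.+2%:R < 3 * K ->
  0 < \sum_(1 <= i < k.+3) lambda H i.
Proof.
move=> kn sH hQ m0 C0 tau0 hb bk K0 lam rho hH hB cK.
have rho0 : 0 < rho by rewrite lt_def eucl_norm_eq0 m0 eucl_norm_ge0.
have [e [es eB <-]] := lowest_eigenframe _ _ sH kn.
have sQ := sum_sq_orthoproj _ _ _ _ hQ eB.
have b0 : 0 <= b by rewrite hb mulr_ge0// ?eucl_norm_ge0// mulr_ge0.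
set q := \sum_i sq (e i *m Q) in sQ.
pose D := \sum_i dot m (e i) ^+ 2.
have hD : D <= rho ^+ 2 by rewrite /rho sqr_eucl_norm; exact: eB.
have hP : \sum_i (sq (e i *m (1%:M - Q)) - b * sq (e i *m Q)) = k.+2%:R - (1 + b) * q.
  rewrite /q mulr_sumr -es -sumrB; apply: eq_bigr => i _.
  by rewrite (orthoproj_pythagoras _ _ (e i) hQ); ring.
have hsum := ler_sum (index_enum _) (fun i (_ : true) => hH (e i)).
rewrite sumrB big_split /= -!mulr_sumr hP in hsum.
rewrite (_ : \sum_i (2 * dot m (e i)) ^+ 2 = 4 * D) in hsum; last first.
  by rewrite /D mulr_sumr; apply: eq_bigr => i _; ring.
have hBs : - (c * k.+2%:R) <= \sum_i quadform B (e i).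
  rewrite -es mulr_sumr -sumrN ler_sum// => i _.
  by have := hB (e i); rewrite ler_norml => /andP[].
(* The tangential share q of the frame is at most k, so at least two units of trace remain normal,
   up to the curvature loss b k. *)
have T1 : 2 - b * k%:R <= k.+2%:R - (1 + b) * q.
  have : (1 + b) * q <= (1 + b) * k%:R by rewrite ler_wpM2l// addr_ge0.
  by rewrite -[k.+2]addn2 natrD; clear; lra.
set T := k.+2%:R - (1 + b) * q in hsum T1.
apply: lt_le_trans (_ : 3 * K - c * k.+2%:R <= _); first by rewrite subr_gt0.
suff : 3 * K <= - (tau * ((rho ^+ 4)^-1 + lam * (4 * rho ^+ 3)^-1)) * (4 * D) +
    barrier' K tau lam (rho ^+ 2) * (2 * T).
  by clear -hsum hBs; lra.
have lam0 : 0 <= lam by rewrite /lam !mulr_ge0.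
have i1 : 0 <= (rho ^+ 4)^-1 + lam * (4 * rho ^+ 3)^-1.
  by rewrite addr_ge0 ?invr_ge0 ?exprn_ge0 ?(ltW rho0)// mulr_ge0// invr_ge0 mulr_ge0// exprn_ge0// ltW.
have i2 : 0 <= (rho ^+ 2)^-1 + lam * (2 * rho)^-1.
  by rewrite addr_ge0 ?invr_ge0 ?exprn_ge0 ?(ltW rho0)// mulr_ge0// invr_ge0 mulr_ge0// ltW.
have j1 : tau * ((rho ^+ 4)^-1 + lam * (4 * rho ^+ 3)^-1) * (4 * D) <=
    tau * ((rho ^+ 4)^-1 + lam * (4 * rho ^+ 3)^-1) * (4 * rho ^+ 2).
  by rewrite ler_wpM2l ?mulr_ge0// ler_wpM2l.
have j2 : (K + tau * ((rho ^+ 2)^-1 + lam * (2 * rho)^-1)) * (2 * (2 - b * k%:R)) <=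
   (K + tau * ((rho ^+ 2)^-1 + lam * (2 * rho)^-1)) * (2 * T).
  by rewrite ler_wpM2l ?addr_ge0 ?mulr_ge0// ler_wpM2l.
have j3 : K * 3 <= K * (2 * (2 - b * k%:R)) by rewrite ler_wpM2l//; clear -bk; lra.
(* Up to the factor tau / rho this reads 4 / rho + lam <= (2 / rho + lam)(2 - b k). The terms 4 /
   rho cancel; b k / rho = lam / 4 and b k <= 1/2 bound the two losses by lam / 2 each. This is the
   origin of 32 in lam. *)
have j4 : tau * ((rho ^+ 4)^-1 + lam * (4 * rho ^+ 3)^-1) * (4 * rho ^+ 2) <=
   tau * ((rho ^+ 2)^-1 + lam * (2 * rho)^-1) * (2 * (2 - b * k%:R)).
  rewrite -[leLHS]mulrA -[leRHS]mulrA ler_wpM2l//.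
  have -> : ((rho ^+ 4)^-1 + lam * (4 * rho ^+ 3)^-1) * (4 * rho ^+ 2) =
     (4 * rho^-1 + lam) * rho^-1 by field; rewrite gt_eqF.
  have -> : ((rho ^+ 2)^-1 + lam * (2 * rho)^-1) * (2 * (2 - b * k%:R)) =
     (2 * rho^-1 + lam) * (2 - b * k%:R) * rho^-1 by field; rewrite gt_eqF.
  rewrite ler_wpM2r ?invr_ge0 ?(ltW rho0)//.
  have bE : rho^-1 * (b * k%:R) = lam / 4.
    by rewrite hb /lam -/rho; field; rewrite gt_eqF.
  have lb : lam * (b * k%:R) <= lam * 2^-1 by rewrite ler_wpM2l.
  clear -bE lb lam0; lra.
rewrite /barrier' sqrtr_sqr gtr0_norm//.
clear -j1 j2 j3 j4; lra.
Qed.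

(* Completing the square in the tangential variable: E is a graph over its
   tangent space up to a quadratic error, which costs b sq (h Q). *)
Lemma sq_dist_lower_bound (k : nat) Q m h t (C : R) : orthoproj k Q -> m *m Q = 0 -> 0 <= C ->
  eucl_norm (t *m (1%:M - Q)) <= C * sq t -> eucl_norm h <= eucl_norm m ->
  4 * C * eucl_norm m <= 2^-1 ->
  sq (m + h *m (1%:M - Q)) - 8 * C * eucl_norm m * sq (h *m Q) <= sq (m + h - t).
Proof.
move=> hQ mQ C0 ht hm hC; set P := 1%:M - Q in ht *.
pose w := m + h *m P.
have PQ : P *m Q = 0 by case: hQ => _ QQ _; rewrite mulmxBl mul1mx QQ subrr.
have mP : m *m P = m by rewrite mulmxBr mulmx1 mQ subr0.
have eP x : sq (x *m P) <= sq x by rewrite [leRHS](orthoproj_pythagoras _ _ x hQ) lerDr sq_ge0.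
have e1 : sq (m + h - t) = sq ((h - t) *m Q) + sq (w - t *m P).
  rewrite (orthoproj_pythagoras _ _ (m + h - t) hQ) -/P.
  have -> : (m + h - t) *m Q = (h - t) *m Q by rewrite -addrA mulmxDl mQ add0r.
  by rewrite (mulmxBl (m + h)) (mulmxDl m h) mP.
have nw : eucl_norm w <= 2 * eucl_norm m.
  apply: le_trans (eucl_normD _ _) _; have : eucl_norm (h *m P) <= eucl_norm h.
    by rewrite !eucl_normE ler_wsqrtr.
  by move=> h1; clear -h1 hm; lra.
have hd : `|dot w (t *m P)| <= 2 * C * eucl_norm m * sq t.
  apply: le_trans (normr_dot_le _ _) _.
  apply: (@le_trans _ _ ((2 * eucl_norm m) * (C * sq t))); last by rewrite le_eqVlt; apply/orP; left; apply/eqP; ring.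
  by rewrite ler_pM// eucl_norm_ge0.
have pt := orthoproj_pythagoras _ _ t hQ; rewrite -/P in pt.
rewrite e1 -/w mulmxBl !sqB.
move: hd; rewrite ler_norml => /andP[_ hd].
have := cauchy_schwarz (h *m Q) (t *m Q).
(* With be = 4 C |m|, the weight c = 1 + 2 be satisfies 1 / c <= 1 - be since be <= 1/2. So (1 - be)
   |t Q|^2 absorbs the cross term, and the excess c - 1 is the coefficient of |h Q|^2 in the
   claim. *)
pose c := 1 + 8 * C * eucl_norm m.
have c1 : 0 < c by rewrite /c ltr_pwDl// mulr_ge0 ?eucl_norm_ge0// mulr_ge0.
have sqc := sq_ge0 (c *: (h *m Q) - t *m Q).
rewrite sqB sqZ dotZl in sqc.
have b0 : 0 <= 4 * C * eucl_norm m by rewrite mulr_ge0 ?eucl_norm_ge0// mulr_ge0.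
have T0 := sq_ge0 (t *m Q); have TP0 := sq_ge0 (t *m P).
rewrite pt in hd.
have cE : c = 1 + 2 * (4 * C * eucl_norm m) by rewrite /c; ring.
have -> : 8 * C * eucl_norm m = 2 * (4 * C * eucl_norm m) by ring.
have {}hd : 2 * dot w (t *m P) <= 4 * C * eucl_norm m * (sq (t *m Q) + sq (t *m P)) by clear -hd; lra.
move: (4 * C * eucl_norm m) hC b0 cE hd => be be1 be0 cE hd _.
have k1 : be * sq (t *m P) <= sq (t *m P) by rewrite -[leRHS]mul1r ler_wpM2r//; clear -be1; lra.
have k2 : 0 <= c * (c * sq (h *m Q) - 2 * dot (h *m Q) (t *m Q) + (1 - be) * sq (t *m Q)).
  have : sq (t *m Q) <= c * (1 - be) * sq (t *m Q).
    by rewrite -[leLHS]mul1r ler_wpM2r// cE; clear -be0 be1; nra.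
  clear -sqc; lra.
rewrite pmulr_rge0// cE in k2.
clear -k1 k2 hd; lra.
Qed.

End BarrierContact.

(** * Nearest points and the exclusion of barrier contact *)

Section NearestPoint.
Context {R : realType} {n : nat}.
Implicit Types (x z p e : 'rV[R]_n) (M Q : 'M[R]_n) (E F W : set 'rV[R]_n).

Lemma lipschitz_eucl_continuous (f : 'rV[R]_n -> R) :
  (forall x z, `|f x - f z| <= eucl_norm (x - z)) -> continuous f.
Proof.
move=> hf x; apply/(cvgrPdist_lt (F := nbhs x) f (f x)) => eps eps0.
have N0 : 0 < n%:R + 1 :> R by rewrite ltr_wpDl.
suff h : \forall t \near x, `|f x - f t| < eps by exact: h.
apply/nbhs_normP; exists (eps / (n%:R + 1)); first by rewrite /= divr_gt0.
move=> t; rewrite /ball_/= ltr_pdivlMr// => ht; apply: le_lt_trans (hf x t) _.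
apply: le_lt_trans (eucl_norm_le _) _; apply: le_lt_trans ht.
by rewrite mulrC ler_wpM2l// lerDl.
Qed.

Lemma nearest_points F : F !=set0 -> compact F ->
  exists pi : 'rV[R]_n -> 'rV[R]_n, (forall x, F (pi x)) /\
    forall x z, F z -> eucl_norm (x - pi x) <= eucl_norm (x - z).
Proof.
move=> F0 cF; have h x : exists c, F c /\ forall z, F z -> eucl_norm (x - c) <= eucl_norm (x - z).
  have cc : continuous (fun z => eucl_norm (x - z)).
    refine (lipschitz_eucl_continuous _ _) => a b.
    have h1 := eucl_normD (x - b) (b - a); have h2 := eucl_normD (x - a) (a - b).
    rewrite !addrA !subrK in h1 h2.
    rewrite -(eucl_normN (b - a)) opprB in h1.
    by rewrite ler_norml; apply/andP; split; clear -h1 h2; lra.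
  have [c Fc hc] := compact_min F _ F0 cF (fun t _ => cc t).
  by exists c.
have [pi hpi] := choice h.
by exists pi; split=> [x|x z]; have [? ?] := hpi x => //; auto.
Qed.

(** Along each line through x0, one quadratic polynomial bounds |x - z|^2 from below for all z in F
    at once, with equality at x0 for z = z0. It replaces d^2 in the second-derivative test, and
    [barrier_trace_pos] concludes. *)
Lemma barrier_no_contact (k : nat) W F (u v d : 'rV[R]_n -> R) p x0 z0 M Q (C K tau c : R) :
  (k.+2 <= n)%N -> open W -> W x0 -> C_on 2 W u -> C_on 2 W v ->
  symmx M -> symmx (hess u x0) -> orthoproj k Q ->
  (x0 - z0) *m Q = 0 -> x0 - z0 != 0 -> 0 <= C -> 0 <= tau -> 0 <= K ->
  (forall z, F z -> eucl_norm ((z - z0) *m (1%:M - Q)) <= C * sq (z - z0)) ->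
  d x0 = eucl_norm (x0 - z0) -> (forall x, exists2 z, F z & d x = eucl_norm (x - z)) ->
  8 * C * eucl_norm (x0 - z0) <= 2^-1 -> 8 * C * eucl_norm (x0 - z0) * k%:R <= 2^-1 ->
  (forall e, `|quadform (hess v x0) e + 2 * quadform M e| <= c * sq e) ->
  c * k.+2%:R < 3 * K ->
  let G x := u x - v x - quadform M (x - p) - barrier K tau (32 * C * k%:R) (d x ^+ 2) in
  (\forall x \near x0, G x0 <= G x) ->
  0 < \sum_(1 <= i < k.+3) lambda (hess u x0) i.
Proof.
move=> kn oW Wx hu hv sM sH hQ mQ m0 C0 tau0 K0 htan dx0 hd hC hk hB cK G hmin.
set m := x0 - z0 in mQ m0 dx0 hC hk.
have rho0 : 0 < eucl_norm m by rewrite lt_def eucl_norm_eq0 m0 eucl_norm_ge0.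
have lam0 : 0 <= 32 * C * k%:R by rewrite !mulr_ge0.
set b := 8 * C * eucl_norm m in hC hk.
apply: (barrier_trace_pos k _ (hess v x0 + 2 *: M) Q m C b K tau c) => //; last first.
  by move=> e; rewrite quadformD quadformZ.
set lam := 32 * C * k%:R in G hmin lam0 *; move=> e.
(* The lower bound of [sq_dist_lower_bound] for h = s e, expanded in s; its linear term keeps all of
   e because m is normal. *)
pose S (s : R) := eucl_norm m ^+ 2 + 2 * dot m e * s + (sq (e *m (1%:M - Q)) - b * sq (e *m Q)) * s ^+ 2.
have S0 : S 0 = eucl_norm m ^+ 2 by rewrite /S mulr0 expr0n /= mulr0 !addr0.
have SE s : S s = sq (m + (s *: e) *m (1%:M - Q)) - b * sq ((s *: e) *m Q).
  rewrite /S -!scalemxAl sqD !sqZ dotZr sqr_eucl_norm.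
  have -> : dot m (e *m (1%:M - Q)) = dot m e.
    by rewrite mulmxBr mulmx1 dotDr dotNr -(orthoproj_dot _ _ _ _ hQ) mQ dot0l subr0.
  ring.
have nS : \forall s \near (0 : R), 0 < S s /\ S s <= d (x0 + s *: e) ^+ 2.
  have n1 : \forall s \near (0 : R), 0 < S s.
    have cS := is_derive1_continuous _ _ _ (is_derive_quadratic (eucl_norm m ^+ 2) (2 * dot m e)
       (sq (e *m (1%:M - Q)) - b * sq (e *m Q)) 0).
    apply: (cvgr_gt (S 0) cS); rewrite S0 exprn_gt0//.
  have n2 : \forall s \near (0 : R), `|s| < eucl_norm m / (eucl_norm e + 1).
    apply/nbhs_norm0P; exists (eucl_norm m / (eucl_norm e + 1)) => //=.
    by rewrite divr_gt0// ltr_wpDl// eucl_norm_ge0.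
  near=> s; split; first by near: s.
  have hs : `|s| < eucl_norm m / (eucl_norm e + 1) by near: s.
  have [z Fz ->] := hd (x0 + s *: e).
  rewrite SE sqr_eucl_norm.
  have -> : x0 + s *: e - z = m + s *: e - (z - z0).
    by rewrite /m; apply/rowP => j; rewrite !mxE; ring.
  apply: (sq_dist_lower_bound k) => //; first exact: htan.
    rewrite eucl_normZ; rewrite ltr_pdivlMr in hs; last by rewrite ltr_wpDl// eucl_norm_ge0.
    by have := eucl_norm_ge0 e; have := normr_ge0 s; clear -hs; nra.
  by clear -hC C0 rho0; rewrite /b in hC; move: (C * eucl_norm m) (mulr_ge0 C0 (ltW rho0)) hC => q q0; lra.
have JB : jet2 (barrier K tau lam \o S) (fun s => barrier' K tau lam (S s) * (2 * dot m e +
     2 * (sq (e *m (1%:M - Q)) - b * sq (e *m Q)) * s)) _ :=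
  jet2_comp S _ _ (barrier K tau lam) (barrier' K tau lam)
    (- (tau * ((eucl_norm m ^+ 4)^-1 + lam * (4 * eucl_norm m ^+ 3)^-1))) [set t | 0 < t]
    (@open_gt R 0) (ltac:(by rewrite /= S0 exprn_gt0))
    (fun t ht => is_derive_barrier K tau lam t ht)
    (ltac:(by rewrite S0; exact: is_derive_barrier')) (jet2_quadratic _ _ _).
have J := jet2B _ _ _ _ _ _ (jet2B _ _ _ _ _ _
   (jet2B _ _ _ _ _ _ (C2_jet2 _ _ _ e oW Wx hu) (C2_jet2 _ _ _ e oW Wx hv))
   (jet2_quadratic (quadform M (x0 - p)) (2 * dot ((x0 - p) *m M) e) (quadform M e))) JB.
have [|_ h] := jet2_min _ _ _ J.
  have h := near_line x0 e _ hmin; near=> s.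
  have /= hG : G x0 <= G (x0 + s *: e) by near: s.
  have [s1 s2] : 0 < S s /\ S s <= d (x0 + s *: e) ^+ 2 by near: s.
  have hb := ler_barrier K tau lam _ _ K0 tau0 lam0 s1 s2.
  rewrite /= scale0r addr0 S0 !mulr0 expr0n /= mulr0 !addr0.
  rewrite /G dx0 (addrAC x0 _ (- p)) (quadform_line _ _ _ _ sM) in hG.
  apply: le_trans hG _; rewrite lerB//.
rewrite mulr0 addr0 S0 subr_ge0 in h.
by apply: le_trans h _; rewrite quadformD quadformZ opprD addrA.
Unshelve. all: by end_near.
Qed.

End NearestPoint.

(** * Positive gap near one point of E *)

Section GapNearPoint.
Context {R : realType} {n : nat}.
Implicit Types (x z p e : 'rV[R]_n) (M N Q : 'M[R]_n) (U : set 'M[R]_n).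

Lemma gap_near_point (k : nat) (Omega E : set 'rV[R]_n) U
    (L : 'rV[R]_n * R * 'rV[R]_n -> 'M[R]_n) (u v : 'rV[R]_n -> R) p :
  (k.+2 <= n)%N -> open Omega -> compact E -> smooth_submanifold k E -> E `<=` Omega -> E p ->
  U `<=` symmx ->
  (forall M N, U M -> posdefmx N -> U (M + N)) ->
  property_P k U -> (forall q, symmx (L q)) -> locally_lipschitz L ->
  C_on 2 (Omega `\` E) u ->
  (forall x, (Omega `\` E) x -> \sum_(1 <= i < k.+3) lambda (hess u x) i <= 0) ->
  C_on 2 Omega v ->
  (forall x, (Omega `\` E) x -> closure U (Atilde L u x)) ->
  (forall x, Omega x -> (symmx `\` U) (Atilde L v x)) ->
  (forall x, (Omega `\` E) x -> v x < u x) ->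
  exists rho eta : R, [/\ 0 < rho, 0 < eta &
    forall x, (Omega `\` E) x -> `|x - p| < rho -> eta <= u x - v x].
Proof.
move=> kn oO cE sE EO Ep Usym Umono UP Lsym Llip hu hlam hv hAu hAv huv.
have n0 : (0 < n)%N by apply: leq_trans kn.
have kn' : (k <= n)%N by apply: leq_trans kn; rewrite -addn2 leq_addr.
have clE : closed E by apply: compact_closed cE; exact: norm_hausdorff.
have oD : open (Omega `\` E) by rewrite setDE; apply: openI => //; exact: closed_openC.
have [r0 [C0 [y [r00 C00 [hy hy0] hdist htan]]]] := submanifold_local_geometry k E p n0 kn' sE Ep.
have pr0 : sup_ball p r0 p by rewrite /sup_ball/= subrr normr0.
have [Qp [hQp tanp _]] := htan p Ep pr0.
have [r1 [eps [kap [Mw [r10 eps0 kap0 sMw hlow]]]]] := linear_growth k Omega E U L u v p Qp r0 C0 y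
  n0 kn' oO clE EO Ep Usym Umono UP Lsym Llip hu hv hAu hAv huv hQp r00 C00 hy hy0 tanp.
have [rv [Cv [rv0 Cv0 subO hvb]]] := C2_locally_bounded _ _ _ oO (EO p Ep) hv.
pose nn : R := n%:R.
have nn1 : 1 <= nn by rewrite /nn ler1n.
have nn0 : 0 < nn by apply: lt_le_trans nn1.
(* A compact cap of E on which the local geometry at p applies; distances are taken to F. The second
   condition is vacuous and only matches the form of [compact_superlevel]. *)
pose F := [set z : 'rV[R]_n | `|z - p| <= r0 / 2 /\ forall _ : unit, 0 <= (0 : R)] `&` E.
have cF : compact F.
  apply: compact_closedI => //; apply: (compact_superlevel _ _ _ (fun _ _ => 0)) => _ x _.
  exact: cst_continuous.
have FP z : E z -> `|z - p| <= r0 / 2 -> F z by move=> Ez hz; split=> //; split.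
have FE z : F z -> E z by case.
have Fin z : F z -> sup_ball p r0 z.
  by move=> [[hz _] _]; rewrite /sup_ball/=; clear -hz r00; lra.
have Fp : F p by apply: FP => //; rewrite subrr normr0 divr_ge0// ltW.
have [pi [piF pimin]] := nearest_points F (ex_intro _ p Fp) cF.
pose d x := eucl_norm (x - pi x).
have d_ge0 x : 0 <= d x by exact: eucl_norm_ge0.
have dle x z : F z -> d x <= eucl_norm (x - z) by exact: pimin.
have dlip x z : `|d x - d z| <= eucl_norm (x - z).
  have h1 : d x <= eucl_norm (x - z) + d z.
    by apply: le_trans (dle x _ (piF z)) _; have := eucl_normD (x - z) (z - pi z); rewrite addrA subrK.
  have h2 : d z <= eucl_norm (x - z) + d x.
    apply: le_trans (dle z _ (piF x)) _; have := eucl_normD (z - x) (x - pi x).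
    by rewrite addrA subrK -(eucl_normN (z - x)) opprB.
  by rewrite ler_norml; apply/andP; split; clear -h1 h2; lra.
have cd := lipschitz_eucl_continuous d dlip.
pose M := eps *: Mw - 1%:M.
have sM : symmx M by apply: symmxD; [exact: symmxZ | apply: symmxN; exact: symmx_scalar].
have qM x : quadform M x = eps * quadform Mw x - sq x.
  by rewrite quadformB quadformZ quadform1.
pose c := Cv * nn + 2 * (`|M| * nn).
have c0 : 0 <= c.
  have h1 : 0 <= Cv * nn by apply: mulr_ge0; exact: ltW.
  have h2 : 0 <= `|M| * nn by apply: mulr_ge0 => //; exact: ltW.
  by rewrite /c; clear -h1 h2; lra.
(* c bounds the form of Hess v + 2 M; over k + 2 directions it must stay below the 3 K supplied by
   the barrier. *)
pose K := c * k.+2%:R + 1.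
have K0 : 0 < K by rewrite /K ltr_wpDl// mulr_ge0.
pose lam := 32 * C0 * k%:R.
have lam0 : 0 <= lam by apply: mulr_ge0 => //; apply: mulr_ge0 => //; exact: ltW.
(* The rate of linear growth in d: some |y_i| is at least d / (nn C0). *)
pose c1 := eps * kap / (nn * C0).
have c10 : 0 < c1 by rewrite divr_gt0// mulr_gt0.
(* As d <= nn r on the ball, the pair (nn * K, c1) gives K d^2 <= c1 d, the pair (nn, 1) gives ln
   (d^2) <= 0, and (8 * nn, r0) keeps nearest points well inside F. *)
have [r rgt0 hr] := ex_small [:: (1, 1); (1, r1); (2, rv); (C0 * 2, r0); (2, r0); (nn * K, c1); (nn, 1);
    (8 * C0 * nn, 2^-1); (8 * C0 * nn * k%:R, 2^-1); (8 * nn, r0)]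
   ltac:(by rewrite /= ltr01 r10 rv0 r00 c10 invr_gt0 ltr0n).
have hr' A B (h : (A, B) \in _) : r * A <= B :=
  le_trans (ler_wpM2l (ltW rgt0) (ler_norm A)) (hr (A, B) h).
have q1 := hr' 1 1 ltac:(by rewrite !inE eqxx ?orbT).
have q2 := hr' 1 r1 ltac:(by rewrite !inE eqxx ?orbT).
have q3 := hr' 2 rv ltac:(by rewrite !inE eqxx ?orbT).
have q4 := hr' (C0 * 2) r0 ltac:(by rewrite !inE eqxx ?orbT).
have q5 := hr' 2 r0 ltac:(by rewrite !inE eqxx ?orbT).
have q6 := hr' (nn * K) c1 ltac:(by rewrite !inE eqxx ?orbT).
have q7 := hr' nn 1 ltac:(by rewrite !inE eqxx ?orbT).
have q8 := hr' (8 * C0 * nn) (2^-1) ltac:(by rewrite !inE eqxx ?orbT).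
have q9 := hr' (8 * C0 * nn * k%:R) (2^-1) ltac:(by rewrite !inE eqxx ?orbT).
have q10 := hr' (8 * nn) r0 ltac:(by rewrite !inE eqxx ?orbT).
clear hr hr'; rewrite !mulr1 in q1 q2.
have inO x : `|x - p| <= r -> Omega x.
  by move=> h; apply: subO; rewrite /sup_ball/=; clear -h q3 rgt0; lra.
have inr0 x : `|x - p| <= r -> sup_ball p r0 x.
  by move=> h; rewrite /sup_ball/=; clear -h q5 rgt0; lra.
have dr x : `|x - p| <= r -> d x <= r * nn.
  move=> h; apply: le_trans (dle x p Fp) _; apply: le_trans (eucl_norm_le _) _.
  by rewrite mulrC ler_wpM2r// ltW.
have low x : `|x - p| <= r -> ~ E x -> K * d x ^+ 2 + sq (x - p) <= u x - v x - quadform M (x - p).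
  move=> hx Ex; have [z [i [Ez hz1 hz2]]] := hdist x (inr0 x hx).
  have Fz : F z.
    apply: FP => //; apply: le_trans hz1 _.
    have : C0 * `|x - p| <= C0 * r by rewrite ler_pM2l.
    by clear -q4; lra.
  have h1 : d x <= nn * (C0 * `|y i x|).
    apply: le_trans (dle x z Fz) _; apply: le_trans (eucl_norm_le _) _.
    by rewrite ler_pM2l.
  have h2 := hlow x (le_trans hx q2) Ex i.
  have h3 : c1 * d x <= eps * kap * `|y i x|.
    apply: le_trans (ler_wpM2l (ltW c10) h1) _; rewrite le_eqVlt; apply/orP; left; apply/eqP.
    by rewrite /c1; field; apply/andP; split; rewrite gt_eqF.
  have h4 : K * d x ^+ 2 <= c1 * d x.
    rewrite expr2 mulrA ler_wpM2r//; apply: (@le_trans _ _ (K * (r * nn))).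
      by rewrite ler_pM2l// dr.
    by rewrite (_ : K * (r * nn) = r * (nn * K))//; ring.
  by rewrite qM; clear -h2 h3 h4; lra.
have dgt0 x : ~ E x -> 0 < d x.
  move=> Ex; rewrite lt_def d_ge0 andbT eucl_norm_eq0 subr_eq0; apply/eqP => e.
  by apply: Ex; rewrite e; exact: FE.
have dE x : E x -> `|x - p| <= r -> d x = 0.
  move=> Ex hx; apply: le_anti; rewrite d_ge0 andbT.
  have Fx : F x by apply: FP => //; clear -hx q5; lra.
  by apply: le_trans (dle x x Fx) _; rewrite eucl_normE subrr sq0 sqrtr0.
(* On |x - p| = r the term |x - p|^2 contributes at least r^2 = 2 eta, of which the lam term may use
   one eta. *)
pose eta := r ^+ 2 / 2.
have eta0 : 0 < eta by rewrite divr_gt0// exprn_gt0.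
pose Cw := 2 * `|M| * n%:R ^+ 3.
have [rho rho0 hrho] := ex_small [:: (1, r); (Cw, eta / 4)] ltac:(by rewrite /= rgt0 divr_gt0).
have rr : rho <= r.
  by have := hrho (1, r) (mem_head _ _); rewrite /= normr1 mulr1.
have rC : rho * Cw <= eta / 4.
  apply: le_trans (hrho (Cw, eta / 4) ltac:(by rewrite !inE eqxx orbT)).
  by rewrite ler_wpM2l ?ler_norm// ltW.
exists rho, (eta / 4); split=> // [|x1 Dx1 hx1]; first by rewrite divr_gt0.
rewrite leNgt; apply/negP => bad.
have hx1r : `|x1 - p| <= r by apply: le_trans rr; exact: ltW.
have [Ox1 Ex1] := Dx1.
(* tau may depend on the supposed bad point x1, since rho and the gap eta / 4 are already fixed.
   This takes the place of the limit tau to 0. *)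
have [tau tau0 htau] := ex_small [:: (lam, r ^+ 2 / 2); (ln (d x1 ^+ 2), eta / 4)]
   ltac:(by rewrite /= !divr_gt0// exprn_gt0).
have t1 : tau * lam <= eta.
  apply: le_trans (htau (lam, r ^+ 2 / 2) (mem_head _ _)).
  by rewrite ler_wpM2l ?ler_norm// ltW.
have t2 : - (tau * ln (d x1 ^+ 2)) <= eta / 4.
  apply: le_trans (htau (ln (d x1 ^+ 2), eta / 4) ltac:(by rewrite !inE eqxx orbT)).
  by rewrite -mulrN ler_wpM2l ?(ltW tau0)//= -normrN ler_norm.
clear htau hrho.
pose G x := u x - v x - quadform M (x - p) - barrier K tau lam (d x ^+ 2).
have bE x : barrier K tau lam (d x ^+ 2) = K * d x ^+ 2 + tau * ln (d x ^+ 2) + tau * lam * d x.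
  by rewrite /barrier sqrtr_sqr ger0_norm//; ring.
have d1 x : `|x - p| <= r -> d x <= 1 by move=> h; apply: le_trans (dr x h) q7.
have Glow x : `|x - p| <= r -> ~ E x -> sq (x - p) - tau * ln (d x ^+ 2) - tau * lam <= G x.
  move=> hx Ex; have h1 := low x hx Ex; rewrite /G bE.
  have h2 : tau * lam * d x <= tau * lam.
    by rewrite -[leRHS]mulr1 ler_wpM2l ?d1// mulr_ge0// ltW.
  by clear -h1 h2; lra.
have Gx1 : G x1 < eta.
  have [h1 _] := quadform_small M `|M| rho (x1 - p) n0 (mx_coord_le M) (ltW hx1) (le_trans rr q1).
  have h2 : - quadform M (x1 - p) <= eta / 4.
    apply: le_trans (ler_norm _) _; rewrite normrN; apply: le_trans h1 _.
    by rewrite mulrC.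
  have h3 : 0 <= K * d x1 ^+ 2 by rewrite mulr_ge0 ?exprn_ge0// ltW.
  have h4 : 0 <= tau * lam * d x1 by rewrite mulr_ge0// mulr_ge0// ltW.
  by rewrite /G bE; clear -bad h2 h3 h4 t2 eta0; lra.
have Gbd x : `|x - p| = r -> ~ E x -> eta <= G x.
  move=> hx Ex; have hx' : `|x - p| <= r by rewrite hx.
  apply: le_trans (Glow x hx' Ex).
  have h1 : r ^+ 2 <= sq (x - p) by rewrite -hx; exact: norm_le_sq.
  have h2 : tau * ln (d x ^+ 2) <= 0.
    by rewrite mulr_ge0_le0 ?(ltW tau0)// ln_le0// exprn_ile1// d1.
  have -> : eta = r ^+ 2 - eta by rewrite /eta; field.
  by clear -h1 h2 t1; lra.
(* The value of d^2 below which -tau ln (d^2) - tau lam exceeds eta: the logarithm keeps the minimum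
   away from E. *)
pose delta0 := expR (- (eta / tau + lam)).
have Gsmall x : `|x - p| <= r -> ~ E x -> d x ^+ 2 < delta0 -> eta < G x.
  move=> hx Ex hd; apply: lt_le_trans (Glow x hx Ex).
  have h1 : ln (d x ^+ 2) < - (eta / tau + lam).
    by rewrite -(expRK (- (eta / tau + lam))) ltr_ln// posrE ?expR_gt0// exprn_gt0// dgt0.
  have h2 : tau * ln (d x ^+ 2) < tau * - (eta / tau + lam) by rewrite ltr_pM2l.
  have h3 : tau * - (eta / tau + lam) = - eta - tau * lam by field; rewrite gt_eqF.
  by rewrite h3 in h2; have h4 := sq_ge0 (x - p); clear -h2 h4; lra.
pose A := [set x : 'rV[R]_n | `|x - p| <= r /\ forall _ : unit, 0 <= d x ^+ 2 - delta0].
have cd2 x : {for x, continuous (fun t => d t ^+ 2)}.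
  by apply: (@continuousM _ _ d d); exact: cd.
have cA : compact A.
  apply: (compact_superlevel _ _ _ (fun _ x => d x ^+ 2 - delta0)) => _ x hx.
  by apply: (@continuousB _ _ _ (fun t => d t ^+ 2) (cst delta0)); [exact: cd2 | exact: cst_continuous].
have AE x : A x -> (Omega `\` E) x.
  move=> [hx /(_ tt) h]; split; first exact: inO.
  move=> Ex; move: h; rewrite (dE x Ex hx) expr0n /= sub0r oppr_ge0.
  by rewrite leNgt expR_gt0.
have Ax1 : A x1.
  split=> // _; rewrite subr_ge0 leNgt; apply/negP => /(Gsmall x1 hx1r Ex1).
  by rewrite ltNge ltW.
have cG x : A x -> {for x, continuous G}.
  move=> Ax; have [_ Ex] := AE x Ax.
  apply: (@continuousB _ _ _ (fun t => u t - v t - quadform M (t - p)) (fun t => barrier K tau lam (d t ^+ 2))).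
    apply: (@continuousB _ _ _ (fun t => u t - v t) (fun t : 'rV[R]_n => quadform M (t - p))).
      apply: continuousB; first exact: C_on_continuous hu (AE x Ax).
      by apply: C_on_continuous hv _; exact: (AE x Ax).1.
    have csub : {for x, continuous (fun t : 'rV[R]_n => t - p)}.
      by apply: (@continuousB _ _ _ id (cst p) x); [move=> B hB | exact: cst_continuous].
    exact: (@continuous_comp _ _ _ (fun t : 'rV[R]_n => t - p) (quadform M) x csub (continuous_quadform M _)).
  have dx2 : 0 < d x ^+ 2 by rewrite exprn_gt0// dgt0.
  exact: (@continuous_comp _ _ _ (fun t => d t ^+ 2) (barrier K tau lam) x (cd2 x)
    (is_derive1_continuous _ _ _ (is_derive_barrier K tau lam _ dx2))).
have [x0 Ax0 minx0] := compact_min _ _ (ex_intro _ x1 Ax1) cA cG.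
have Dx0 := AE x0 Ax0; have [Ox0 Ex0] := Dx0.
have G0 : G x0 < eta by apply: le_lt_trans Gx1; exact: minx0.
have hx0r : `|x0 - p| <= r by case: Ax0.
have hx0 : `|x0 - p| < r.
  rewrite lt_neqAle hx0r andbT; apply/eqP => xr.
  by have := Gbd x0 xr Ex0; rewrite leNgt G0.
have near0 : \forall x \near x0, G x0 <= G x.
  have n1 : \forall x \near x0, (Omega `\` E) x by apply: open_nbhs_nbhs.
  have n2 : \forall x \near x0, `|x - p| < r.
    exact: (open_nbhs_nbhs (conj (open_sup_ball p r) hx0)).
  near=> x.
  have hxr : `|x - p| < r by near: x.
  have [_ Ex] : (Omega `\` E) x by near: x.
  have [ge|lt] := leP delta0 (d x ^+ 2).
    by apply: minx0; split; [exact: ltW | move=> _; rewrite subr_ge0].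
  by apply/ltW/(lt_trans G0)/Gsmall => //; exact: ltW.
set z0 := pi x0 in (dx0 := erefl (d x0) : d x0 = eucl_norm (x0 - pi x0)).
(* z0 is nearest in F only; lying strictly inside the cap, it is locally nearest in E, as the
   normality clause demands. *)
have zp : `|z0 - p| < r0 / 2.
  apply: le_lt_trans (normr_le_eucl_norm _) _.
  have h1 := eucl_normD (z0 - x0) (x0 - p); rewrite addrA subrK in h1.
  rewrite -(eucl_normN (z0 - x0)) opprB in h1.
  have h2 : eucl_norm (x0 - z0) <= r * nn by exact: dr.
  have h3 : eucl_norm (x0 - p) <= r * nn.
    by apply: le_trans (eucl_norm_le _) _; rewrite mulrC ler_wpM2r// ltW.
  by clear -h1 h2 h3 q10 r00; lra.
have Fz0 : F z0 := piF x0.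
have [Q [hQ tanQ normQ]] := htan z0 (FE _ Fz0) (Fin _ Fz0).
have mQ : (x0 - z0) *m Q = 0.
  apply: (normQ x0 (r0 / 2 - `|z0 - p|)); first by rewrite subr_gt0.
  move=> z Ez hz; rewrite -!sqr_eucl_norm lerXn2r// ?nnegrE ?eucl_norm_ge0//.
  apply: dle; apply: FP => //.
  by have := ler_normD (z - z0) (z0 - p); rewrite addrA subrK; clear -hz; lra.
have m0 : x0 - z0 != 0 by rewrite -eucl_norm_eq0 gt_eqF// (dgt0 x0 Ex0).
have dx0r : eucl_norm (x0 - z0) <= r * nn by exact: dr.
have sA := closure_symmx U Usym _ (hAu x0 Dx0).
(* Symmetry of the Hessian is read off from Atilde^u in the closure of U and from the symmetry of
   L. *)
have sH : symmx (hess u x0).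
  have -> : hess u x0 = - (Atilde L u x0 - L (x0, u x0, grad u x0)).
    by rewrite /Atilde addrK opprK.
  by apply: symmxN; apply: symmxD => //; exact: symmxN.
have [_ _ vb2] : [/\ `|v x0| <= Cv, forall i, `|partial i v x0| <= Cv &
      forall i j, `|partial i (partial j v) x0| <= Cv].
  by apply: hvb; rewrite /sup_ball/=; clear -hx0r q3 rgt0; lra.
have C80 : 0 <= 8 * C0 by apply: mulr_ge0 => //; exact: ltW.
have := barrier_no_contact k (Omega `\` E) F u v d p x0 z0 M Q C0 K tau c kn oD Dx0 hu
  (C_on_sub _ _ _ _ (@subDsetl _ Omega E) hv) sM sH hQ mQ m0 (ltW C00) (ltW tau0) (ltW K0).
move=> /(_ (fun z Fz => tanQ z (FE _ Fz) (Fin _ Fz)) erefl (fun x => ex_intro2 _ _ (pi x) (piF x) erefl)).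
have b1 : 8 * C0 * eucl_norm (x0 - z0) <= 2^-1.
  by apply: le_trans q8; rewrite [leRHS]mulrCA ler_wpM2l.
have b2 : 8 * C0 * eucl_norm (x0 - z0) * k%:R <= 2^-1.
  by apply: le_trans q9; rewrite mulrA ler_wpM2r// [leRHS]mulrCA ler_wpM2l.
have b3 e : `|quadform (hess v x0) e + 2 * quadform M e| <= c * sq e.
  apply: le_trans (ler_normD _ _) _; rewrite /c [leRHS]mulrDl lerD//.
    by apply: quadform_le => i j; rewrite mxE.
  rewrite normrM ger0_norm// -mulrA ler_wpM2l//.
  exact: (quadform_le M `|M| e (mx_coord_le M)).
have b4 : c * k.+2%:R < 3 * K.
  have : 0 <= c * k.+2%:R by rewrite mulr_ge0.
  by rewrite /K; clear; lra.
move=> /(_ b1 b2 b3 b4 near0).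
by rewrite ltNge hlam.
Unshelve. all: by end_near.
Qed.

End GapNearPoint.

(** * From local gaps to the lower limit *)

Lemma uniform_gap (R : realType) (n : nat) (D E : set 'rV[R]_n) (f : 'rV[R]_n -> R) :
  compact E ->
  (forall p, E p -> exists rho eta : R, [/\ 0 < rho, 0 < eta &
     forall x, D x -> `|x - p| < rho -> eta <= f x]) ->
  exists2 t : R, 0 < t & forall p x, E p -> D x -> `|x - p| < t -> t <= f x.
Proof.
move=> cE h.
(* One number t is both radius and gap, so near each point of E the property holds for all small t >
   0, and compactness yields a common t. *)
pose P (t : R) (p : 'rV[R]_n) := forall x, D x -> `|x - p| < t -> t <= f x.
have nP : \forall t \near (0 : R)^'+, E `<=` P t.
  apply: ((compact_near_coveringP E).1 cE R _ P _) => p Ep.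
  have [rho [eta [rho0 eta0 hp]]] := h p Ep.
  have n1 : \forall q \near p, `|p - q| < rho / 2.
    by apply/nbhs_normP; exists (rho / 2) => //=; rewrite divr_gt0.
  have n2 : \forall t \near (0 : R)^'+, t < Num.min (rho / 2) eta.
    by apply: nbhs_right_lt; rewrite lt_min eta0 divr_gt0.
  near=> q t => x Dx hx.
  have hq : `|p - q| < rho / 2 by near: q.
  have : t < Num.min (rho / 2) eta by near: t.
  rewrite lt_min => /andP[t1 t2].
  apply: (le_trans (ltW t2)); apply: hp => //.
  have h1 := ler_normD (x - q) (q - p); rewrite addrA subrK (distrC q p) in h1.
  rewrite (splitr rho); apply: le_lt_trans h1 _; apply: ltrD => //.
  exact: lt_trans t1.
have n0 : \forall t \near (0 : R)^'+, 0 < t by exact: nbhs_right_gt.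
have n1 : \forall t \near (0 : R)^'+, E `<=` P t /\ 0 < t.
  by near=> t; split; [near: t | near: t].
have [t [ht t0]] := @filter_ex _ _ (at_right_proper_filter (0 : R)) _ n1.
by exists t => // p x Ep; exact: ht.
Unshelve. all: by end_near.
Qed.

Theorem theorem1p6 (R : realType) (n k : nat)
    (Omega E : set 'rV[R]_n) (U : set 'M[R]_n)
    (L : 'rV[R]_n * R * 'rV[R]_n -> 'M[R]_n)
    (u v : 'rV[R]_n -> R)
    (hn : (2 <= n)%N)
    (hOmega : domain Omega)
    (hk : (1 <= k <= n - 2)%N)
    (hE : closed_submanifold k E)
    (hEOmega : E `<=` Omega)
    (hUopen : open_in_symmx U)
    (hUmono : forall M N : 'M[R]_n, U M -> posdefmx N -> U (M + N))
    (hUP : property_P k U)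
    (hLsym : forall p, symmx (L p))
    (hL : locally_lipschitz L)
    (hu : C_on 2 (Omega `\` E) u)
    (hlam : forall x, (Omega `\` E) x ->
      \sum_(1 <= i < k.+3) lambda (hess u x) i <= 0)
    (hv : C_on 2 Omega v)
    (hAu : forall x, (Omega `\` E) x -> closure U (Atilde L u x))
    (hAv : forall x, Omega x -> (symmx `\` U) (Atilde L v x))
    (huv : forall x, (Omega `\` E) x -> v x < u x) :
  (0 < limf_einf (fun x => (u x - v x)%:E) (approach (Omega `\` E) E))%E.
Proof.
(* Subtraction is truncated on natural numbers; [hn] makes k <= n - 2 mean k + 2 <= n. *)
have kn : (k.+2 <= n)%N.
  by case/andP: hk => _ h; rewrite -(subnK hn) -addn2 leq_add2r.
have Usym : U `<=` symmx by case: hUopen => V _ ->; exact: subIsetr.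
have [_ _ oO] := hOmega; have [cE sE] := hE.
have [t t0 ht] := uniform_gap _ _ (Omega `\` E) E (fun x => u x - v x) cE
  (fun p Ep => gap_near_point k Omega E U L u v p kn oO cE sE hEOmega Ep Usym hUmono hUP
     hLsym hL hu hlam hv hAu hAv huv).
(* The lower limit is minus the upper limit of v - u, which is at most the supremum of v - u over
   the single set dist < t, hence at most -t. *)
rewrite /limf_einf oppe_gt0.
apply: (@le_lt_trans _ _ (- t)%:E); last by rewrite lte_fin oppr_lt0.
pose A := [set x | (Omega `\` E) x /\ (dist x E < t%:E)%E].
have FA : approach (Omega `\` E) E A by exists t.
rewrite /limf_esup; apply: (@le_trans _ _ (ereal_sup [set (- (u x - v x)%:E)%E | x in A])).
  by apply: ereal_inf_lbound; exists A.
apply: ge_ereal_sup => _ [x [Dx dx] <-].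
rewrite -EFinN lee_fin lerN2.
have [_ [z Ez <-] hz] : exists2 a, [set (eucl_norm (x - z))%:E | z in E] a & (a < t%:E)%E.
  by apply: ereal_inf_lt.
apply: (ht z x Ez Dx); apply: le_lt_trans (normr_le_eucl_norm _) _.
by rewrite -lte_fin.
Qed.
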